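(* Let $(C,\rho)$ be a complete CAT(1) space with the N-property and with diameter smaller than $\pi/2$. Let $T\colon C\to C$ be a nonexpansive mapping with $\mathrm{Fix}\,T\neq\emptyset$. Let $M\in(0,\pi/2)$ and let $f\colon C\to C$ be a $k$-contraction with $$k<\frac{2\sin^2\frac{M}{2}\,\cos M}{M^2}.$$ Assume further that $\rho(p,f(p))\le M/4$ for all $p\in \mathrm{Fix}\,T$. Then there is a unique fixed point $q\in \mathrm{Fix}\,T$ for which $$P_{\mathrm{Fix}\,T}(f(q))=q.$$ Moreover, for each point $u\in C$ such that $\rho(u,q)\le M/4$ and for each pair of real sequences $(b_n)_{n\ge1}$, $(t_n)_{n\ge1}$ satisfying (i) $b_n,t_n\in(0,1)$ for all $n\in\mathbb{N}$; (ii) $0<\liminf_{n\to\infty} b_n\le\limsup_{n\to\infty} b_n<1$; (iii) $\lim_{n\to\infty}t_n=0$; (iv) $\sum_{n=1}^\infty t_n=\infty$, the sequence $(x_n)$ defined by $$x_1=u,\qquad y_n=t_nf(x_n)+(1-t_n)T(x_n),\qquad x_{n+1}=b_nx_n+(1-b_n)y_n\quad(n\ge1)$$ converges to $q$.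
   Context: A CAT(1) space is a geodesic metric space $(X,\rho)$ in which every geodesic triangle of perimeter less than $2\pi$ satisfies $\rho(y_1,y_2)\le d(\bar y_1,\bar y_2)$ for all points $y_1,y_2$ on it and their comparison points $\bar y_1,\bar y_2$ on the comparison triangle in the unit sphere $\mathbb{S}^2$ (with the spherical distance $d$). Points at distance less than $\pi$ are joined by a unique geodesic segment $[x,y]$; for $\alpha\in(0,1)$, $\alpha x+(1-\alpha)y$ denotes the point $z$ of $[x,y]$ with $\rho(x,z)=(1-\alpha)\rho(x,y)$ and $\rho(z,y)=\alpha\rho(x,y)$. A set $S$ is $\pi$-convex if $[x,y]\subset S$ for all $x,y\in S$ with $\rho(x,y)<\pi$. For a nonempty closed $\pi$-convex subset $S$ of a complete CAT(1) space and a point $x$ with $\rho(x,S)=\inf_{s\in S}\rho(x,s)<\pi/2$, $P_S(x)$ denotes the (unique) point of $S$ nearest to $x$. N-property: a CAT(1) space $X$ has the N-property if for every (nonempty) closed $\pi$-convex set $S\subset X$ and all $x_1,x_2\in X$ with $\rho(x_i,S)<\pi/2$, $\rho(x_1,x_2)<\pi/2$ and $P_S(x_1)=P_S(x_2)=P$, one has $P_S(\alpha x_1+(1-\alpha)x_2)=P$ for every $\alpha\in(0,1)$. $T$ is nonexpansive if $\rho(Tx,Ty)\le\rho(x,y)$ for all $x,y$; $\mathrm{Fix}\,T=\{x: Tx=x\}$. $f$ is a $k$-contraction (with $0\le k<1$) if $\rho(f(x),f(y))\le k\rho(x,y)$ for all $x,y$. *)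

(* Defs.v *)
From HB Require Import structures.
From mathcomp Require Import all_boot all_order all_algebra.
From mathcomp Require Import all_classical all_reals all_analysis.

Set Implicit Arguments.
Unset Strict Implicit.
Unset Printing Implicit Defensive.

Import Order.TTheory GRing.Theory Num.Theory.
Import numFieldNormedType.Exports.

Local Open Scope classical_set_scope.
Local Open Scope ring_scope.

(* The library's Complete structure is pointed. *)
#[short(type="completeMetricType")]
HB.structure Definition CompleteMetric (K : numDomainType) :=
  {T of Complete T & Metric K T}.

Section geodesics.
Context {R : realType} {X : Type} (d : X -> X -> R).

(* Geodesics are parametrized by arc length on [0, d x y]; values of c outside
   this interval are irrelevant. *)
Definition geodesic (x y : X) (c : R -> X) : Prop :=
  [/\ c 0 = x, c (d x y) = y &
      forall s t, 0 <= s <= d x y -> 0 <= t <= d x y ->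
        d (c s) (c t) = `|s - t|].

Definition geodesic_space : Prop := forall x y, exists c, geodesic x y c.

(* The union of all geodesic segments from x to y, hence [x, y] whenever there
   is only one. *)
Definition segment (x y : X) : set X :=
  [set z | exists c, geodesic x y c /\
           exists t, 0 <= t <= d x y /\ c t = z].

(* The i-th side goes from the i-th vertex to the next one, cyclically. *)
Definition geodesic_triangle (v : 'I_3 -> X) (c : 'I_3 -> R -> X) : Prop :=
  forall i, geodesic (v i) (v (ordS i)) (c i).

Definition side_length (v : 'I_3 -> X) (i : 'I_3) : R := d (v i) (v (ordS i)).

Definition perimeter (v : 'I_3 -> X) : R := \sum_i side_length v i.

End geodesics.

Section sphere.
Context {R : realType}.

Definition dot (u v : 'rV[R]_3) : R := \sum_i u 0 i * v 0 i.

Definition sphere2 : Type := {u : 'rV[R]_3 | dot u u = 1}.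

Definition sphere_dist (u v : sphere2) : R := acos (dot (sval u) (sval v)).

End sphere.

Section cat1.
Context {R : realType} (X : metricType R).
Local Notation rho := (@mdist R X).

(* Since sides are parametrized by arc length and corresponding sides have equal
   lengths, the comparison point of c i s is c' i s. *)
Definition CAT1 : Prop :=
  geodesic_space rho /\
  forall (v : 'I_3 -> X) (c : 'I_3 -> R -> X)
         (v' : 'I_3 -> @sphere2 R) (c' : 'I_3 -> R -> @sphere2 R),
    geodesic_triangle rho v c -> perimeter rho v < 2 * pi ->
    geodesic_triangle sphere_dist v' c' ->
    side_length sphere_dist v' =1 side_length rho v ->
    forall (i j : 'I_3) (s t : R),
      0 <= s <= side_length rho v i -> 0 <= t <= side_length rho v j ->
      rho (c i s) (c j t) <= sphere_dist (c' i s) (c' j t).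

(* z = a x + (1 - a) y; note that a is the weight of x. *)
Definition convex_comb (a : R) (x y z : X) : Prop :=
  [/\ segment rho x y z, rho x z = (1 - a) * rho x y & rho z y = a * rho x y].

Definition pi_convex (S : set X) : Prop :=
  forall x y, S x -> S y -> rho x y < pi -> segment rho x y `<=` S.

Definition set_dist (x : X) (S : set X) : R := inf [set rho x s | s in S].

(* P_S(x) = p: p is the only point of S realizing the distance from x to S. *)
Definition is_proj (S : set X) (x p : X) : Prop :=
  unique (fun s => S s /\ rho x s = set_dist x S) p.

Definition N_property : Prop :=
  forall S : set X, S !=set0 -> closed S -> pi_convex S ->
  forall x1 x2 p : X,
    set_dist x1 S < pi / 2 -> set_dist x2 S < pi / 2 -> rho x1 x2 < pi / 2 ->
    is_proj S x1 p -> is_proj S x2 p ->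
  forall a z, 0 < a < 1 -> convex_comb a x1 x2 z -> is_proj S z p.

(* Extended-real, so that an unbounded space has diameter +oo. *)
Definition diameter : \bar R :=
  ereal_sup [set (rho p.1 p.2)%:E | p in [set: X * X]].

Definition nonexpansive (T : X -> X) : Prop :=
  forall x y, rho (T x) (T y) <= rho x y.

Definition k_contraction (k : R) (f : X -> X) : Prop :=
  0 <= k < 1 /\ forall x y, rho (f x) (f y) <= k * rho x y.

Definition Fix (T : X -> X) : set X := [set x | T x = x].

(* Sequences are indexed from 0: b n, t n, x n, y n stand for the terms of index
   n + 1 of the sequences indexed from 1. *)
Definition viscosity_iteration (T f : X -> X) (b t : nat -> R) (u : X)
    (x y : nat -> X) : Prop :=
  x 0%N = u /\
  forall n, convex_comb (t n) (f (x n)) (T (x n)) (y n) /\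
            convex_comb (b n) (x n) (y n) (x n.+1).

End cat1.

(* Main.v *)
Require Import Defs.
From HB Require Import structures.
From mathcomp Require Import all_boot all_order all_algebra.
From mathcomp Require Import all_classical all_reals all_analysis.
From mathcomp Require Import ring lra.

Set Implicit Arguments.
Unset Strict Implicit.
Unset Printing Implicit Defensive.

Import Order.TTheory GRing.Theory Num.Theory.
Import numFieldNormedType.Exports.

Local Open Scope classical_set_scope.
Local Open Scope ring_scope.

(** The spherical cosine inequality carries the whole proof. If [z] lies on the
    segment from [x] to [y], comparison with a triangle in the sphere gives
    [sin (rho x y) cos (rho z p) >= sin (rho z y) cos (rho x p)
    + sin (rho x z) cos (rho y p)]
    for every point [p] ([cos_segment]); in the sphere this is the linearity of
    the scalar product with [p]. It replaces the scalar product of a Hilbert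
    space in what follows. Two of its consequences are used throughout: moving
    two points the same proportion of the way to a common point contracts their
    distance ([comb_contraction]), and four points satisfy the inequality which
    expresses [|p - q + r - v|^2 >= 0] in the sphere ([cos_quadrilateral]).

    Nearest fixed points. For an anchor [u] and a ratio [s] in [(0, 1)], the map
    sending [z] to [s u + (1 - s) T z] is a contraction. Its fixed point [z] lies
    near [T z], so that [T x] being close to [x] makes the angle at [z] between
    [u] and [x] almost obtuse. When [s] tends to [0] fast enough these fixed
    points form a Cauchy sequence, whose limit [w] is fixed by [T] and satisfies
    [cos (rho u x) <= cos (rho u w) cos (rho w x) + e] as soon as [rho x (T x)] is
    small ([approximate_projection]). For [x] fixed by [T] this says that the
    angle at [w] is at least [pi / 2], hence that [w] is the nearest fixed point;
    for [x] almost fixed by [T] it takes the place of a weak compactness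
    argument.

    The point [q]. The hypothesis on [k] gives [k <= cos M / 2 <= 1 / 2], and a
    fixed point [p] is within [pi / 8] of [f p]. The quadrilateral inequality,
    applied to two points and to their nearest fixed points, shows that the nearest
    point map composed with [f] is a contraction of the set of fixed points.

    Convergence. Put [phi x = 1 - cos (rho x q)]. The iterates stay in the ball of
    radius [M / 2] about [q]. If [x n] is almost fixed by [T], then the obtuse
    angle at [q] between [f q] and [x n] and the quadrilateral inequality for
    [f (x n)], [x n], [q], [f q] make the move towards [f (x n)] decrease [phi] at
    a rate proportional to [t n phi (x n)], up to [e t n] ([first_variation]). If
    not, [x n] is far from [y n] when [t n] is small, and the uniform convexity of
    the sphere makes the average of [x n] and [y n] decrease [phi] by a fixed
    amount ([averaging_gain]), which exceeds every multiple of [t n] in the long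
    run. In both cases
    [phi (x (n + 1)) <= (1 - c t n) phi (x n) + e t n] for large [n]
    ([iteration_step]), and the divergence of the series of the [t n] gives the
    convergence of [phi (x n)] to [0] ([vanishing_recursion]). *)

(** * Trigonometric inequalities *)

Section trigonometry.
Context {R : realType}.
Implicit Types a b l x y s D : R.

Lemma pi_bounds : 2 <= (pi : R) < 4.
Proof. by have := @pihalf_lt2 R; have := @pi_ge2 R; lra. Qed.

Lemma sin_MVT x y : x <= y ->
  exists2 c, x <= c <= y & sin y - sin x = cos c * (y - x) :> R.
Proof.
move=> xy; have [|c] := @MVT_segment R sin cos x y xy (fun z _ => is_derive_sin z).
  by apply: continuous_subspaceT => z; exact: continuous_sin.
by rewrite in_itv /= => cxy ->; exists c.
Qed.

Lemma cos_MVT x y : x <= y ->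
  exists2 c, x <= c <= y & cos x - cos y = sin c * (y - x) :> R.
Proof.
move=> xy; have [|c] := @MVT_segment R cos (fun z => - sin z) x y xy
  (fun z _ => is_derive_cos z).
  by apply: continuous_subspaceT => z; exact: continuous_cos.
by rewrite in_itv /= => cxy e; exists c => //; lra.
Qed.

Lemma sin_le_id x : 0 <= x -> sin x <= x.
Proof.
move=> x0; have [c _] := sin_MVT x0.
by rewrite sin0 !subr0 => ->; have := cos_le1 c; nra.
Qed.

Lemma cos_lipschitz x y : cos x <= cos y + `|x - y|.
Proof.
have [xy|/ltW yx] := leP x y.
  have [c _] := cos_MVT xy.
  by rewrite ler0_norm ?subr_le0//; have := sin_le1 c; nra.
have [c _] := cos_MVT yx.
by rewrite ger0_norm ?subr_ge0//; have := sin_geN1 c; nra.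
Qed.

Lemma cos_le_mono x y : 0 <= x -> x <= y -> y <= pi -> cos y <= cos x.
Proof.
move=> x0 xy ypi; have [c cxy] := cos_MVT xy.
by have : 0 <= sin c by [apply: sin_ge0_pi; lra]; nra.
Qed.

Lemma cos_ge_le x y : 0 <= x <= pi -> 0 <= y <= pi -> cos y <= cos x -> x <= y.
Proof.
move=> xpi ypi; apply: contraTT; rewrite -!ltNge => yx.
by rewrite ltr_cos// in_itv.
Qed.

Lemma cos_lt1 x : 0 < x <= pi -> cos x < 1.
Proof. by move=> xpi; rewrite -[ltRHS]cos0 ltr_cos ?in_itv/=; lra. Qed.

(** The mean value theorem on both sides of [s * a], the derivative of sine being
    decreasing on the half circle. *)
Lemma sin_concave s a : 0 <= a <= pi -> 0 <= s <= 1 -> s * sin a <= sin (s * a).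
Proof.
move=> api s01.
have [c1 c1P] := @sin_MVT 0 (s * a) ltac:(nra).
have [c2 c2P] := @sin_MVT (s * a) a ltac:(nra).
rewrite sin0 !subr0 => e2 e1.
have cc : cos c2 <= cos c1 by apply: cos_le_mono; nra.
have : 0 <= s * (1 - s) * a by rewrite !mulr_ge0//; lra.
nra.
Qed.

Lemma sin_ge_half x : 0 <= x <= pi / 2 -> x / 2 <= sin x.
Proof.
move=> xP; have pb := pi_bounds.
have := @sin_concave (x / (pi / 2)) (pi / 2) ltac:(lra).
rewrite sin_pihalf mulr1 divfK; last by rewrite gt_eqF//; lra.
have h : x / 2 <= x / (pi / 2).
  by rewrite ler_wpM2l ?lef_pV2 ?posrE//; lra.
move=> H; apply: (le_trans h); apply: H.
by rewrite divr_ge0 ?ler_pdivrMr//; lra.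
Qed.

Lemma sin_shrink s a D : 0 <= s <= 1 -> 0 <= a <= D -> D < pi / 2 ->
  sin ((1 - s) * a) <= (1 - s * cos D) * sin a.
Proof.
move=> s01 aD Dpi.
have -> : (1 - s) * a = a - s * a by lra.
rewrite sinB; have sa : 0 <= sin a by apply: sin_ge0_pi; lra.
have := @sin_concave s a ltac:(lra) s01.
have := cos_le1 (s * a); have cD : cos D <= cos a by apply: cos_le_mono; lra.
have c0 : 0 <= cos D by apply: cos_ge0_pihalf; lra.
have : 0 <= (cos a - cos D) * (s * sin a) by rewrite !mulr_ge0//; lra.
nra.
Qed.

Lemma cosB1_sin x : 1 - cos x = 2 * sin (x / 2) ^+ 2.
Proof. by rewrite [in LHS](splitr x) cosD; have := cos2Dsin2 (x / 2); nra. Qed.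

Lemma cos_half x : cos x = 2 * cos (x / 2) ^+ 2 - 1.
Proof. by have := cosB1_sin x; have := cos2Dsin2 (x / 2); lra. Qed.

Lemma cosB1_le_sq x : 0 <= x -> 1 - cos x <= x ^+ 2 / 2.
Proof.
move=> x0; rewrite cosB1_sin.
have := @sin_le_id (x / 2) ltac:(lra); have [s0|s0] := leP 0 (sin (x / 2)).
  by nra.
have [xpi|xpi] := leP (x / 2) pi.
  by have := @sin_ge0_pi R (x / 2) ltac:(lra); lra.
have := sin_geN1 (x / 2); have := @pi_ge2 R; nra.
Qed.

Lemma cosB1_double x : 1 - cos x = 2 * (1 - cos (x / 2)) * (1 + cos (x / 2)).
Proof.
by rewrite cosB1_sin; have := cos2Dsin2 (x / 2); nra.
Qed.

(** A contraction for the chordal distance [2 sin (d / 2)] is one for [d], with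
    the same factor: by concavity, [l sin (y / 2) <= sin (l y / 2)]. *)
Lemma chord_contraction l x y : 0 <= x <= pi -> 0 <= y <= pi -> 0 <= l <= 1 ->
  1 - cos x <= l ^+ 2 * (1 - cos y) -> x <= l * y.
Proof.
move=> xpi ypi l01; rewrite !cosB1_sin => h.
have sx : 0 <= sin (x / 2) by apply: sin_ge0_pi; lra.
have sy : 0 <= sin (y / 2) by apply: sin_ge0_pi; lra.
have h1 : sin (x / 2) <= l * sin (y / 2).
  rewrite -(@ler_pXn2r _ 2)// ?nnegrE ?mulr_ge0//; last by lra.
  by rewrite exprMn; lra.
have h2 := @sin_concave l (y / 2) ltac:(lra) l01.
apply: cos_ge_le; [lra|nra|].
suff : sin (x / 2) ^+ 2 <= sin (l * y / 2) ^+ 2.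
  by have := cosB1_sin x; have := cosB1_sin (l * y); lra.
rewrite -mulrA lerXn2r ?nnegrE ?(le_trans h1)//.
by rewrite (le_trans _ h2)// mulr_ge0//; lra.
Qed.

Lemma sin_double_sum a b : sin (a + a) + sin (b + b) =
  sin (a + b + (a + b)) + 4 * sin (a + b) * sin a * sin b.
Proof.
rewrite !(sinD, cosD).
have : sin a * cos a * (cos b ^+ 2 + sin b ^+ 2) = sin a * cos a.
  by rewrite cos2Dsin2 mulr1.
have : sin b * cos b * (cos a ^+ 2 + sin a ^+ 2) = sin b * cos b.
  by rewrite cos2Dsin2 mulr1.
lra.
Qed.

Lemma cos_pi4 : 7 / 10 <= cos (pi / 4) :> R.
Proof.
have pb := pi_bounds.
have c4 : 0 <= cos (pi / 4) :> R by apply: cos_ge0_pihalf; lra.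
have := cos_half (pi / 2 : R); have -> : pi / 2 / 2 = pi / 4 :> R by lra.
by rewrite cos_pihalf; nra.
Qed.

Lemma cos_pi8 : 23 / 25 <= cos (pi / 8) :> R.
Proof.
have pb := pi_bounds; have := cos_pi4.
have c8 : 0 <= cos (pi / 8) :> R by apply: cos_ge0_pihalf; lra.
have := cos_half (pi / 4 : R); have -> : pi / 4 / 2 = pi / 8 :> R by lra.
by nra.
Qed.

End trigonometry.

(** * Real sequences *)

Section real_sequences.
Context {R : realType}.
Implicit Types (a b t : nat -> R) (e g : R).

Lemma inv_fact_decay n m : (n < m)%N ->
  (m.+2`!%:R)^-1 <= (n.+2`!%:R)^-1 / n.+1%:R :> R.
Proof.
elim: m => // m IHm; rewrite ltnS leq_eqVlt => /predU1P[->|/IHm nm].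
  rewrite [in leLHS]factS natrM invfM mulrC ler_wpM2l ?invr_ge0//.
  by rewrite lef_pV2 ?posrE ?ltr0n// ler_nat ltnS (leq_trans (leqnSn m)).
apply: le_trans nm; rewrite lef_pV2 ?posrE ?ltr0n ?fact_gt0// ler_nat.
by rewrite [leqRHS]factS leq_pmull.
Qed.

Lemma inv_fact_le n : 0 < (n.+2`!%:R^-1 : R) <= n.+1%:R^-1.
Proof.
rewrite invr_gt0 ltr0n fact_gt0 lef_pV2 ?posrE ?ltr0n ?fact_gt0// ler_nat.
elim: n => // n; rewrite -[(n < _)%N]/(n.+1 <= _)%N => h.
by rewrite factS (leq_trans _ (leq_pmulr _ (fact_gt0 _))).
Qed.

(** Put [i = inf (a n + de n)]. Then [a m >= i - de m] for all [m], and
    [a m <= i + e / 2] from some index on; so [a] is a Cauchy sequence. *)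
Lemma almost_decreasing_cauchy (a de : nat -> R) e : (forall n, 0 <= a n) ->
  (forall n, 0 <= de n) -> (forall n m, (n < m)%N -> a m <= a n + de n) ->
  de n @[n --> \oo] --> 0 -> 0 < e ->
  exists N, de N <= e /\ forall m, (N <= m)%N -> a N <= a m + e.
Proof.
move=> a0 de0 a_decr de_cvg e0.
pose S := [set a n + de n | n in setT].
have S0 : S !=set0 by exists (a 0%N + de 0%N), 0%N.
have S_lb : has_lbound S by exists 0 => _ [n _ <-]; rewrite addr_ge0.
have [_ [n0 _ <-] n0_inf] := @inf_lt _ S (inf S + e / 2) S0 ltac:(lra).
move/cvgrPdist_lt: de_cvg => /(_ (e / 2) ltac:(lra))[N _ deN].
have de_small n : (N <= n)%N -> de n < e / 2.
  by move=> /deN /=; rewrite sub0r normrN ger0_norm.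
exists (maxn N n0.+1); split.
  by have := de_small (maxn N n0.+1) (leq_maxl _ _); lra.
move=> m Nm; have := a_decr n0 (maxn N n0.+1) (leq_maxr _ _).
have := de_small m (leq_trans (leq_maxl _ _) Nm).
have : inf S <= a m + de m by apply: ge_inf => //; exists m.
lra.
Qed.

Lemma unit_limn_bounds b : (forall n, 0 < b n < 1) ->
  0 < limn_inf b -> limn_sup b < 1 ->
  exists2 g, 0 < g & \forall n \near \oo, g <= b n <= 1 - g.
Proof.
move=> b01 b_inf b_sup.
have b_bnd : bounded_fun b.
  exists 1; split; first exact: num_real.
  move=> c c1 n _ /=; have := b01 n => b01n.
  by rewrite ger0_norm; lra.
move: b_inf b_sup; rewrite limn_infE// limn_supE//.
move=> /sup_gt[|_ [n1 _ <-] inf0]; first by exists (infs b 0%N), 0%N.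
move=> /inf_lt[|_ [n2 _ <-] sup1]; first by exists (sups b 0%N), 0%N.
exists (Num.min (infs b n1) (1 - sups b n2)).
  by rewrite lt_min inf0 subr_gt0.
exists (maxn n1 n2) => // n /=; rewrite geq_max => /andP[n1n n2n].
have h1 : infs b n1 <= b n.
  apply: ge_inf; last by exists n.
  by apply: has_lbound_sdrop; exact: bounded_fun_has_lbound.
have h2 : b n <= sups b n2.
  apply: ub_le_sup; last by exists n.
  by apply: has_ubound_sdrop; exact: bounded_fun_has_ubound.
set m := Num.min _ _.
have [m1 m2] : m <= infs b n1 /\ m <= 1 - sups b n2 by rewrite !ge_min !lexx orbT.
by lra.
Qed.

(** As long as [a n] stays above a given level, it decreases by at least a fixed
    multiple of [t n], which cannot go on because the series diverges; once below
    that level, it stays there. *)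
Lemma vanishing_recursion a t g : 0 < g <= 1 -> (forall n, 0 <= a n) ->
  (forall n, 0 < t n < 1) -> series t n @[n --> \oo] --> +oo ->
  (forall e, 0 < e -> \forall n \near \oo,
    a n.+1 <= (1 - g * t n) * a n + e * t n) ->
  a n @[n --> \oo] --> 0.
Proof.
move=> g01 a0 t01 t_dvg a_rec; apply/cvgrPdist_lt => e e0.
have e'0 : 0 < g * e / 2 by rewrite divr_gt0// mulr_gt0//; lra.
have [N _ recN] := a_rec _ e'0.
have [n0 Nn0 an0] : exists2 n, (N <= n)%N & a n < e.
  apply: contrapT => /forall2NP large.
  have a_large n : (N <= n)%N -> e <= a n.
    by move=> Nn; have [//|/negP] := large n; rewrite -leNgt.
  have drop n : a (N + n)%N <= a N - g * e / 2 * (series t (N + n)%N - series t N).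
    elim: n => [|n IHn]; first by rewrite addn0 subrr mulr0 subr0.
    have Nn := leq_addr n N; have := recN _ Nn; have := a_large _ Nn.
    rewrite addnS => an arec; rewrite /series /= big_nat_recr//= -/(series t _).
    have : g * t (N + n)%N * e <= g * t (N + n)%N * a (N + n)%N.
      by rewrite ler_wpM2l// mulr_ge0//; have := t01 (N + n)%N; lra.
    rewrite -[\sum_(0 <= _ < N + n) _]/(series t (N + n)%N).
    rewrite -[\sum_(0 <= _ < N) _]/(series t N).
    lra.
  move/cvgryPge: t_dvg => /(_ (series t N + (a N + 1) / (g * e / 2))).
  move=> [N' _ big]; have := big (N + N')%N (leq_addl _ _).
  rewrite /= -lerBrDl ler_pdivrMr// => hb.
  by have := drop N'; have := a0 (N + N')%N; lra.
exists n0 => // n /= n0n; rewrite sub0r normrN ger0_norm//.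
rewrite -(subnKC n0n); elim: (n - n0)%N => [|m IHm]; first by rewrite addn0.
rewrite addnS; have := recN _ (leq_trans Nn0 (leq_addr m n0)) => /= arec.
apply: le_lt_trans arec _; have tm := t01 (n0 + m)%N.
have gt0 : 0 < g * t (n0 + m)%N by rewrite mulr_gt0//; lra.
have gt1 : g * t (n0 + m)%N <= 1 by rewrite mulr_ile1//; lra.
have : (1 - g * t (n0 + m)%N) * a (n0 + m)%N <= (1 - g * t (n0 + m)%N) * e.
  by rewrite ler_wpM2l//; lra.
have : 0 < g * t (n0 + m)%N * e by rewrite mulr_gt0.
lra.
Qed.

End real_sequences.

(** * The unit sphere *)

Section sphere_geometry.
Context {R : realType}.
Implicit Types (u v w : 'rV[R]_3) (U V : @sphere2 R) (a b l s t : R).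

Lemma dotC u v : dot u v = dot v u.
Proof. by apply: eq_bigr => i _; rewrite mulrC. Qed.

Lemma dotDl u v w : dot (u + v) w = dot u w + dot v w.
Proof. by rewrite -big_split; apply: eq_bigr => i _; rewrite mxE mulrDl. Qed.

Lemma dotZl l u v : dot (l *: u) v = l * dot u v.
Proof. by rewrite mulr_sumr; apply: eq_bigr => i _; rewrite mxE mulrA. Qed.

Lemma dot_le1 u v : dot u u = 1 -> dot v v = 1 -> dot u v <= 1.
Proof.
move=> uu vv; have : 0 <= dot (u + - 1 *: v) (u + - 1 *: v).
  by apply: sumr_ge0 => i _; rewrite -expr2 sqr_ge0.
rewrite dotDl dotZl ![dot _ (_ + _)]dotC !dotDl !dotZl uu vv (dotC v u).
lra.
Qed.

Definition sphere_point u (uu : dot u u = 1) : sphere2 := exist _ u uu.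

Lemma sphere2_inj U V : sval U = sval V -> U = V.
Proof. by case: U V => [u hu] [v hv] /= uv; exact: eq_exist. Qed.

Definition vec3 (a b c : R) : 'rV[R]_3 := \row_(i < 3) [:: a; b; c]`_i.

Lemma dot_vec3 a b c a' b' c' :
  dot (vec3 a b c) (vec3 a' b' c') = a * a' + b * b' + c * c'.
Proof. by rewrite /dot !big_ord_recl big_ord0 !mxE /= addr0 !addrA. Qed.

(** The great circle arc from [u] to [v], parametrized by arc length when these
    unit vectors are at distance [l]. *)
Definition arc u v l s : 'rV[R]_3 :=
  (sin (l - s) / sin l) *: u + (sin s / sin l) *: v.

Lemma dot_arc u v l s t : dot u u = 1 -> dot v v = 1 -> dot u v = cos l ->
  sin l != 0 -> dot (arc u v l s) (arc u v l t) = cos (s - t).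
Proof.
move=> uu vv uv sl.
rewrite dotDl !dotZl ![dot _ (arc _ _ _ _)]dotC !dotDl !dotZl uu vv (dotC v u) uv.
rewrite !sinB cosB.
transitivity (cos s * cos t + sin s * sin t * ((1 - cos l ^+ 2) / sin l ^+ 2)).
  by field.
by rewrite -sin2cos2 divff ?mulr1// expf_neq0.
Qed.

(** The scalar products with [w] give the distances from the points of the arc to
    the third vertex of a triangle. *)
Lemma sphere_geodesic U V l : dot (sval U) (sval V) = cos l -> 0 <= l < pi ->
  exists2 c, geodesic sphere_dist U V c &
    forall s w, 0 <= s <= l -> sin l * dot (sval (c s)) w =
      sin (l - s) * dot (sval U) w + sin s * dot (sval V) w.
Proof.
move=> UV /andP[l0 lpi].
have dUV : sphere_dist U V = l.
  by rewrite /sphere_dist UV cosK// in_itv/= l0 ltW.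
move: l0; rewrite le_eqVlt => /predU1P[l0|l0].
  (* Here [arc] degenerates, its coefficients being divided by [sin 0]. *)
  have eUV : U = V.
    apply: sphere2_inj; apply/eqP; rewrite -subr_eq0; apply/eqP/rowP => i.
    rewrite mxE; have := svalP U; have := svalP V; move: UV; rewrite -l0 cos0.
    set u := sval U; set v := sval V => uv vv uu.
    have h : dot (u - v) (u - v) = 0.
      rewrite -[- v]scaleN1r dotDl dotZl ![dot _ (_ + _)]dotC !dotDl !dotZl.
      by rewrite uu vv (dotC v u) uv; lra.
    have /psumr_eq0P : \sum_i (u - v) 0 i ^+ 2 = 0 by rewrite -[RHS]h.
    move=> /(_ (fun i _ => sqr_ge0 _) i isT)/eqP.
    by rewrite sqrf_eq0 !mxE => /eqP.
  exists (fun _ => U); last first.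
    move=> s w; rewrite -eUV -l0 => s0.
    have -> : s = 0 by lra.
    by rewrite subr0 sin0 !mul0r addr0.
  split=> // s t; rewrite dUV -l0 => s0 t0.
  have -> : s = 0 by lra. have -> : t = 0 by lra.
  by rewrite subrr normr0 /sphere_dist (svalP U) acos1.
have sl : sin l != 0 by rewrite gt_eqF// sin_gt0_pi// l0.
have arc1 s : dot (arc (sval U) (sval V) l s) (arc (sval U) (sval V) l s) = 1.
  by rewrite (dot_arc _ _ (svalP U) (svalP V) UV sl) subrr cos0.
exists (fun s => sphere_point (arc1 s)); last first.
  by move=> s w _ /=; rewrite dotDl !dotZl; field.
split.
- by apply: sphere2_inj; rewrite /= /arc subr0 sin0 divff//;
    rewrite mul0r scale0r scale1r addr0.
- apply: sphere2_inj.
  by rewrite dUV /= /arc subrr sin0 mul0r scale0r divff// scale1r add0r.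
- move=> s t; rewrite dUV => s0 t0; rewrite /sphere_dist /=.
  rewrite (dot_arc _ _ (svalP U) (svalP V) UV sl) -cos_norm cosK//.
  by rewrite in_itv/= normr_ge0/= ler_norml; lra.
Qed.

(** Vertices of a triangle with side lengths [l], [a], [b]; the last coordinate
    is real because of the triangle inequalities. *)
Lemma sphere_triangle l a b : 0 < l < pi -> 0 <= a -> 0 <= b ->
  l + a + b <= 2 * pi ->
  a <= l + b -> l <= a + b -> b <= l + a ->
  exists U V W : @sphere2 R, [/\ dot (sval U) (sval V) = cos l,
    dot (sval V) (sval W) = cos a & dot (sval W) (sval U) = cos b].
Proof.
move=> l0 a0 b0 per ab lb bl.
have sl : 0 < sin l by rewrite sin_gt0_pi.
have sl0 : sin l != 0 by rewrite gt_eqF.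
have sb : 0 <= sin b by apply: sin_ge0_pi; lra.
pose m := (cos a - cos l * cos b) / sin l.
have cm : sin l * m = cos a - cos l * cos b by rewrite mulrC divfK.
have h1 : cos (l + b) <= cos a.
  have [lbpi|lbpi] := leP (l + b) pi; first by apply: cos_le_mono; lra.
  have -> : cos (l + b) = cos (pi *+ 2 - (l + b)).
    by rewrite -[in RHS]cosN opprB cosB cos2pi sin2pi; lra.
  by rewrite mulr2n; apply: cos_le_mono; lra.
have h2 : cos a <= cos (l - b).
  by rewrite -(cos_norm (l - b)); apply: cos_le_mono => //; rewrite ?ler_norml; lra.
have mb : m ^+ 2 <= sin b ^+ 2.
  rewrite -ler_sqrt ?sqr_ge0// !sqrtr_sqr (ger0_norm sb) ler_norml.
  move: h1 h2; rewrite cosD cosB => h1 h2.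
  by apply/andP; split; rewrite -(ler_pM2l sl) cm; lra.
have uu : dot (vec3 1 0 0) (vec3 1 0 0) = 1 :> R by rewrite dot_vec3; lra.
have vv : dot (vec3 (cos l) (sin l) 0) (vec3 (cos l) (sin l) 0) = 1 :> R.
  by rewrite dot_vec3; have := cos2Dsin2 l; lra.
pose w := vec3 (cos b) m (Num.sqrt (sin b ^+ 2 - m ^+ 2)).
have ww : dot w w = 1.
  rewrite dot_vec3 -[_ * Num.sqrt _]expr2 sqr_sqrtr ?subr_ge0//.
  by have := cos2Dsin2 b; lra.
exists (sphere_point uu), (sphere_point vv), (sphere_point ww).
by rewrite /= !dot_vec3; split; lra.
Qed.

End sphere_geometry.

(** * Comparison inequalities in CAT(1) spaces *)

Section comparison.
Context {R : realType} {X : metricType R}.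
Hypothesis X_CAT1 : CAT1 X.
Hypothesis X_small : forall x y : X, mdist x y < pi / 2.
Local Notation rho := (@mdist R X).
Implicit Types (x y z p : X) (a b s t e D : R).

Lemma rho_pihalf x y : 0 <= rho x y < pi / 2.
Proof. by rewrite mdist_ge0 X_small. Qed.

Lemma rho_pi x y : 0 <= rho x y <= pi.
Proof. by have := rho_pihalf x y; have := @pi_ge0 R; lra. Qed.

Lemma cos_rho_ge0 x y : 0 <= cos (rho x y).
Proof. by apply: cos_ge0_pihalf; have := rho_pihalf x y; lra. Qed.

Lemma cos_rho_gt0 x y : 0 < cos (rho x y).
Proof. by apply: cos_gt0_pihalf; have := rho_pihalf x y; lra. Qed.

Lemma sin_rho_ge0 x y : 0 <= sin (rho x y).
Proof. exact/sin_ge0_pi/rho_pi. Qed.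

(** In the unit sphere this is an equality, because
    [sin (rho x y) z = sin (rho z y) x + sin (rho x z) y] as vectors; comparing
    the triangle [x], [y], [p] with a spherical one gives the general case. All
    other estimates are consequences of this one. *)
Lemma cos_segment x y z p : segment rho x y z ->
  sin (rho z y) * cos (rho x p) + sin (rho x z) * cos (rho y p)
    <= sin (rho x y) * cos (rho z p).
Proof.
move=> [c [cxy [t [t_in ctz]]]].
have [c0 cl cd] := cxy.
have [l0 lpi] := andP (rho_pihalf x y); set l := rho x y in t_in l0 lpi c0 cl cd *.
have xz : rho x z = t.
  by rewrite -c0 -ctz cd ?lexx ?l0// sub0r normrN ger0_norm//; case/andP: t_in.
have zy : rho z y = l - t.
  by rewrite -cl -ctz cd ?lexx ?l0// distrC ger0_norm// subr_ge0; case/andP: t_in.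
rewrite xz zy; have [l_eq0|l_gt0] : l = 0 \/ 0 < l by lra.
  have -> : t = 0 by lra.
  by rewrite l_eq0 subr0 sin0; lra.
have pb := @pi_bounds R.
have yp := rho_pihalf y p; have px := rho_pihalf p x.
have sym := @metric_sym R X; have tri := @metric_triangle R X.
have tri1 : rho y p <= l + rho p x by rewrite /l (sym x y) (sym p x).
have tri2 : l <= rho y p + rho p x by rewrite addrC /l (sym p x) (sym y p).
have tri3 : rho p x <= l + rho y p by rewrite addrC /l (sym y p) (sym x y).
have [U [V [W [UV VW WU]]]] := @sphere_triangle R l (rho y p) (rho p x)
  ltac:(lra) ltac:(lra) ltac:(lra) ltac:(lra) tri1 tri2 tri3.
have [cU cUg cUd] := sphere_geodesic UV ltac:(lra).
have [cV cVg _] := sphere_geodesic VW ltac:(lra).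
have [cW cWg _] := sphere_geodesic WU ltac:(lra).
have [geo cat] := X_CAT1.
have [c1 c1g] := geo y p; have [c2 c2g] := geo p x.
pose v (i : 'I_3) := nth x [:: x; y; p] i.
pose e (i : 'I_3) := nth c [:: c; c1; c2] i.
pose v' (i : 'I_3) := nth U [:: U; V; W] i.
pose e' (i : 'I_3) := nth cU [:: cU; cV; cW] i.
have vg : geodesic_triangle rho v e by move=> [[|[|[|//]]] ?].
have vg' : geodesic_triangle sphere_dist v' e' by move=> [[|[|[|//]]] ?].
have per : perimeter rho v < 2 * pi.
  rewrite /perimeter !big_ord_recl big_ord0 /side_length.
  have := X_small (v ord0) (v (ordS ord0)).
  set i1 := lift _ _; have := X_small (v i1) (v (ordS i1)).
  set i2 := lift _ _; have := X_small (v i2) (v (ordS i2)).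
  by lra.
have sd (A B : sphere2) a : 0 <= a <= pi -> dot (sval A) (sval B) = cos a ->
    sphere_dist A B = a.
  by move=> api AB; rewrite /sphere_dist AB cosK// in_itv.
have len : side_length sphere_dist v' =1 side_length rho v.
  by case=> [[|[|[|//]]] ?]; apply: sd; rewrite ?rho_pi.
have := cat v e v' e' vg per vg' len ord0 ord_max t 0.
rewrite /side_length mdist_ge0 lexx => /(_ t_in isT).
have [c20 _ _] := c2g; have [cW0 _ _] := cWg.
rewrite [e _ _]ctz [e _ _]c20 [e' ord_max _]cW0 -[e' _ _]/(cU t).
move=> zp; move: (cUd t (sval W) t_in); rewrite (dotC (sval U)) WU VW.
rewrite (sym x p) => <-; rewrite ler_wpM2l ?sin_rho_ge0//.
have dW : -1 <= dot (sval (cU t)) (sval W) <= 1.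
  rewrite (dot_le1 (svalP (cU t)) (svalP W)) andbT.
  have sl : 0 < sin l by rewrite sin_gt0_pi//; lra.
  rewrite -(ler_pM2l sl) cUd// (dotC (sval U)) WU VW.
  have : 0 <= sin (l - t) * cos (rho p x).
    by rewrite mulr_ge0 ?cos_rho_ge0// sin_ge0_pi//; lra.
  have : 0 <= sin t * cos (rho y p).
    by rewrite mulr_ge0 ?cos_rho_ge0// sin_ge0_pi//; lra.
  by lra.
rewrite -[leLHS]acosK ?in_itv//=; apply: cos_le_mono zp _; rewrite ?mdist_ge0//.
exact: acos_lepi.
Qed.

Lemma comb_exists a x y : 0 <= a <= 1 -> exists z, convex_comb a x y z.
Proof.
move=> a01; have [geo _] := X_CAT1; have [c cxy] := geo x y.
have [c0 cl cd] := cxy; have l0 := mdist_ge0 x y.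
have t_in : 0 <= (1 - a) * rho x y <= rho x y by nra.
exists (c ((1 - a) * rho x y)); split.
- by exists c; split=> //; exists ((1 - a) * rho x y).
- have := cd 0 _ _ t_in; rewrite c0 lexx l0 => ->//.
  by rewrite sub0r normrN ger0_norm//; case/andP: t_in.
- have := cd _ (rho x y) t_in; rewrite cl lexx l0 => ->//.
  by rewrite distrC ger0_norm; lra.
Qed.

Lemma rho_eq0 x y : rho x y = 0 -> x = y.
Proof. exact: mdist_positivity. Qed.

Lemma comb_diag a x y z : convex_comb a x y z -> rho x y = 0 -> z = x /\ y = x.
Proof.
move=> [_ xz _] xy; split; last exact/esym/rho_eq0.
by apply/esym/rho_eq0; rewrite xz xy mulr0.
Qed.

Lemma sin_rho_gt0 x y : 0 < rho x y -> 0 < sin (rho x y).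
Proof.
move=> xy; rewrite sin_gt0_pi// xy; have := rho_pihalf x y.
by have := @pi_ge2 R; lra.
Qed.

(** The weights [sin (a d) / sin d] and [sin ((1 - a) d) / sin d] of [cos_segment]
    are at least [a] and [1 - a], and cosines of distances are nonnegative. *)
Lemma cos_comb a x y z p : 0 <= a <= 1 -> convex_comb a x y z ->
  a * cos (rho x p) + (1 - a) * cos (rho y p) <= cos (rho z p).
Proof.
move=> a01 azxy; have := mdist_ge0 x y; rewrite le_eqVlt => /predU1P[/esym xy|xy].
  by have [-> ->] := comb_diag azxy xy; lra.
have [seg xz zy] := azxy; have := cos_segment p seg; rewrite xz zy.
have sl := sin_rho_gt0 xy; have xpi := rho_pi x y.
have h1 := sin_concave xpi a01.
have h2 := @sin_concave _ (1 - a) _ xpi ltac:(lra).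
have cx := cos_rho_ge0 x p; have cy := cos_rho_ge0 y p.
move=> h; rewrite -(ler_pM2l sl); apply: le_trans h.
by rewrite mulrDr lerD// mulrA ler_wpM2r// mulrC.
Qed.

(** In the unit sphere both sides are [<x + y, p>]. *)
Lemma cos_midpoint x y m p : convex_comb (1 / 2) x y m ->
  cos (rho x p) + cos (rho y p) <= 2 * cos (rho x y / 2) * cos (rho m p).
Proof.
move=> mid; have := mdist_ge0 x y; rewrite le_eqVlt => /predU1P[/esym xy|xy].
  by have [-> ->] := comb_diag mid xy; rewrite mdistxx mul0r cos0; lra.
have [seg xz zy] := mid; have := cos_segment p seg; rewrite xz zy.
have -> : (1 - 1 / 2) * rho x y = rho x y / 2 by lra.
have -> : 1 / 2 * rho x y = rho x y / 2 by lra.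
rewrite [X in sin X * cos (rho m p)](splitr (rho x y)) sinD.
have sl : 0 < sin (rho x y / 2).
  by rewrite sin_gt0_pi//; have := rho_pi x y; lra.
by move=> h; rewrite -(ler_pM2l sl); lra.
Qed.

(** The sphere version is [0 <= |p - q + r - v|^2] for the unit vectors
    [p], [q], [r], [v]; the midpoint of a diagonal reduces the general case to
    two comparison triangles. *)
Lemma cos_quadrilateral p q r v :
  cos (rho p q) + cos (rho q r) + cos (rho r v) + cos (rho v p)
    <= 2 + cos (rho p r) + cos (rho q v).
Proof.
have [m mid] := @comb_exists (1 / 2) p r ltac:(lra).
have hq := cos_midpoint q mid; have hs := cos_midpoint v mid.
rewrite (metric_sym r q) in hq; rewrite (metric_sym p v) in hs.
have := rho_pihalf m q; have := rho_pihalf m v.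
set A := rho m q in hq *; set B := rho m v in hs * => B0 A0.
have qs : cos (A + B) <= cos (rho q v).
  apply: cos_le_mono; [exact: mdist_ge0| |lra].
  by rewrite /A (metric_sym m q) metric_triangle.
have AB : cos A + cos B <= 2 * cos ((A + B) / 2).
  have -> : A = (A + B) / 2 + (A - B) / 2 by lra.
  have {3}-> : B = (A + B) / 2 - (A - B) / 2 by lra.
  rewrite cosD cosB.
  have : 0 <= cos ((A + B) / 2) by apply: cos_ge0_pihalf; lra.
  have := cos_le1 ((A - B) / 2).
  have -> : ((A + B) / 2 + (A - B) / 2 + B) / 2 = (A + B) / 2 by lra.
  nra.
have := cos_half (rho p r); have := cos_half (A + B).
have : 0 <= cos (rho p r / 2).
  by apply: cos_ge0_pihalf; have := rho_pihalf p r; lra.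
move: (cos (rho p r / 2)) (cos ((A + B) / 2)) AB hq hs => h C AB hq hs h0 cAB cpr.
have : h * (cos A + cos B) <= h * (2 * C) by rewrite ler_wpM2l.
have := sqr_ge0 (h - C).
lra.
Qed.

(** With [a = rho u x], [b = rho u y], [c = rho x y], the spherical value of
    [1 - cos (rho x' y')] is the sum of a radial part
    [1 - cos ((1 - s) (a - b))] and of an angular part
    [sin ((1 - s) a) sin ((1 - s) b) (cos (a - b) - cos c) / (sin a sin b)];
    [sin_shrink] contracts both. *)
Lemma comb_contraction u x y x' y' s D : 0 < s < 1 -> D < pi / 2 ->
  rho u x <= D -> rho u y <= D ->
  convex_comb s u x x' -> convex_comb s u y y' ->
  rho x' y' <= (1 - s * cos D) * rho x y.
Proof.
move=> s01 Dpi aD bD x's y's.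
have D0 : 0 <= D := le_trans (mdist_ge0 _ _) aD.
have cD0 : 0 <= cos D by apply: cos_ge0_pihalf; lra.
have cD1 := cos_le1 D.
have [xs ux' xx'] := x's; have [ys uy' yy'] := y's.
have := mdist_ge0 u x; rewrite le_eqVlt => /predU1P[/esym ux|a0].
  have [-> ->] := comb_diag x's ux; rewrite uy'.
  by rewrite ler_wpM2r ?mdist_ge0//; nra.
have := mdist_ge0 u y; rewrite le_eqVlt => /predU1P[/esym uy|b0].
  have [-> ->] := comb_diag y's uy; rewrite metric_sym ux' (metric_sym x).
  by rewrite ler_wpM2r ?mdist_ge0//; nra.
have sa := sin_rho_gt0 a0; have sb := sin_rho_gt0 b0.
have h1 := cos_segment y' xs; have h2 := cos_segment x ys.
rewrite ux' xx' uy' in h1; rewrite uy' yy' (metric_sym y x) (metric_sym y' x) in h2.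
have cab : cos (rho x y) <= cos (rho u x - rho u y).
  rewrite -(cos_norm (_ - _)); apply: cos_le_mono => //; last first.
    by have := rho_pi x y; lra.
  have := metric_triangle u y x; have := metric_triangle u x y.
  by rewrite (metric_sym y x) ler_norml; lra.
have rad : 1 - cos ((1 - s) * rho u x - (1 - s) * rho u y) <=
    (1 - s * cos D) ^+ 2 * (1 - cos (rho u x - rho u y)).
  rewrite -mulrBr -(cos_norm (_ - _)) -(cos_norm (_ * _)) normrM.
  rewrite [`|1 - s|]ger0_norm; last lra.
  set e := `|_|; have e0 : 0 <= e by exact: normr_ge0.
  have eD : e <= D by rewrite ler_norml; lra.
  rewrite !cosB1_sin [leRHS]mulrCA ler_pM2l// -exprMn.
  have pg := @pi_ge2 R.
  rewrite lerXn2r ?nnegrE//; last by rewrite -mulrA; apply: sin_shrink; lra.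
    by apply: sin_ge0_pi; nra.
  by rewrite mulr_ge0//; [nra|apply: sin_ge0_pi; lra].
have sa' := @sin_shrink _ s (rho u x) D ltac:(lra) ltac:(lra) Dpi.
have sb' := @sin_shrink _ s (rho u y) D ltac:(lra) ltac:(lra) Dpi.
have pg := @pi_ge2 R.
have sa0 : 0 <= sin ((1 - s) * rho u x) by apply: sin_ge0_pi; nra.
have sb0 : 0 <= sin ((1 - s) * rho u y) by apply: sin_ge0_pi; nra.
have ea : s * rho u x = rho u x - (1 - s) * rho u x by lra.
have eb : s * rho u y = rho u y - (1 - s) * rho u y by lra.
rewrite ea sinB in h1; rewrite eb sinB in h2; rewrite cosB in rad.
apply: chord_contraction; [exact: rho_pi|exact: rho_pi|nra|].
rewrite -(ler_pM2l (mulr_gt0 sa sb)).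
have ang : sin ((1 - s) * rho u x) * sin ((1 - s) * rho u y) *
    (cos (rho u x - rho u y) - cos (rho x y)) <=
    ((1 - s * cos D) * sin (rho u x)) * ((1 - s * cos D) * sin (rho u y)) *
    (cos (rho u x - rho u y) - cos (rho x y)).
  by rewrite ler_wpM2r ?subr_ge0// ler_pM.
have rad' := ler_wpM2l (ltW (mulr_gt0 sa sb)) rad.
have h1' := ler_wpM2l (ltW sb) h1.
have h2' := ler_wpM2l sa0 h2.
rewrite cosB in ang cab rad rad'.
lra.
Qed.

(** The conclusion says that the angle at [z] between [u] and [x] is almost at
    least [pi / 2]: otherwise [w], which prolongs the segment from [u] to [z],
    would be further from [x] than [z] by an amount of the order of [s]. *)
Lemma almost_obtuse u w z x s e : 0 < s < 1 -> 0 <= e ->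
  convex_comb s u w z -> rho w x <= rho z x + e ->
  cos (rho u x) <= cos (rho u z) * cos (rho z x) + 2 * s + e / s.
Proof.
move=> s01 e0 zs wx; have es : 0 <= e / s by rewrite divr_ge0//; lra.
have := mdist_ge0 u w; rewrite le_eqVlt => /predU1P[/esym uw|d0].
  by have [-> _] := comb_diag zs uw; rewrite mdistxx cos0; lra.
have [seg uz zw] := zs; have := cos_segment x seg; rewrite uz zw.
set d := rho u w in uz zw d0 *; have dpi := rho_pihalf u w; rewrite -/d in dpi.
have pb := @pi_bounds R.
have cwx : cos (rho z x) - e <= cos (rho w x).
  have [h|h] := leP (rho w x) (rho z x).
    have := @cos_le_mono R (rho w x) (rho z x).
    by rewrite mdist_ge0 h; have := rho_pi z x; lra.
  have := cos_lipschitz (rho z x) (rho w x).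
  by rewrite distrC ger0_norm; lra.
have sd : 0 < sin d by apply: sin_rho_gt0.
have ssd := @sin_concave _ s d ltac:(lra) ltac:(lra).
have ssd0 : 0 < sin (s * d) by nra.
have cd : cos d <= cos ((1 - s) * d) by apply: cos_le_mono; nra.
have c1 : 1 - cos (s * d) <= 2 * s ^+ 2.
  have := @cosB1_le_sq _ (s * d) ltac:(nra); rewrite exprMn.
  have : d ^+ 2 <= 4 by nra.
  have := sqr_ge0 s; nra.
have sd' : sin ((1 - s) * d) <= sin d.
  have := @sin_shrink _ s d d ltac:(lra) ltac:(lra) ltac:(lra).
  have cd0 : 0 <= cos d by apply: cos_ge0_pihalf; lra.
  by have : 0 <= s * cos d * sin d; [rewrite !mulr_ge0//; lra|lra].
have sd0 : 0 <= sin ((1 - s) * d) by apply: sin_ge0_pi; nra.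
have eq1 : sin ((1 - s) * d) = sin d * cos (s * d) - cos d * sin (s * d).
  by rewrite -sinB; congr sin; lra.
move=> h; rewrite -(ler_pM2l ssd0).
have zx0 := cos_rho_ge0 z x; have zx1 := cos_le1 (rho z x).
have h1 : sin ((1 - s) * d) * (cos (rho z x) - e) <=
    sin ((1 - s) * d) * cos (rho w x).
  by rewrite ler_wpM2l.
have h2 : e * sin ((1 - s) * d) <= e * sin d by rewrite ler_wpM2l.
have h3 : e * sin d <= sin (s * d) * (e / s).
  have -> : e * sin d = s * sin d * (e / s) by field; lra.
  by rewrite ler_wpM2r.
have h4 : sin d * (1 - cos (s * d)) * cos (rho z x) <= sin (s * d) * (2 * s).
  apply: (@le_trans _ _ (sin d * (2 * s ^+ 2))); last by nra.
  have : 0 <= 1 - cos (s * d) by have := cos_le1 (s * d); lra.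
  move=> c0; rewrite -mulrA ler_wpM2l ?(ltW sd)//; nra.
have h5 : sin (s * d) * cos (rho z x) * cos d <=
    sin (s * d) * cos (rho z x) * cos ((1 - s) * d).
  by rewrite ler_wpM2l// mulr_ge0// ltW.
rewrite eq1 in h h1 h2.
rewrite eq1 in sd'.
lra.
Qed.

End comparison.

(** * Complete metric spaces *)

Section complete_metric.
Context {R : realType} {X : completeMetricType R}.
Local Notation rho := (@mdist R X).
Implicit Types (x y l : X) (u : nat -> X) (e k : R).

Lemma mdist_cvgP u l : u n @[n --> \oo] --> l <->
  forall e, 0 < e -> \forall n \near \oo, rho l (u n) < e.
Proof. exact: metricType_numDomainType.cvgrPdist_lt. Qed.

Lemma mdist_cauchy_cvg u :
  (forall e, 0 < e -> exists N, forall n, (N <= n)%N -> rho (u N) (u n) < e) ->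
  exists l, u n @[n --> \oo] --> l.
Proof.
move=> u_cauchy; suff /cvg_ex : cvg (u @ \oo) by [].
apply: cauchy_cvg; apply/cauchyP => e e0; have [N uN] := u_cauchy e e0.
exists (u N); rewrite ballEmdist.
by exists N => // n /= /uN.
Qed.

Lemma contraction_fixpoint (S : set X) (g : X -> X) k : closed S -> S !=set0 ->
  (forall x, S x -> S (g x)) -> 0 <= k < 1 ->
  (forall x y, S x -> S y -> rho (g x) (g y) <= k * rho x y) ->
  exists2 x, S x & g x = x.
Proof.
move=> S_closed [x0 Sx0] gS /andP[k0 k1] g_contr.
pose u n := iter n g x0; have uS n : S (u n) by elim: n => //= n /gS.
pose B := rho x0 (g x0) / (1 - k).
have B0 : 0 <= B by rewrite divr_ge0 ?mdist_ge0//; lra.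
have u_bounded m : rho x0 (u m) <= B.
  elim: m => [|m IHm]; first by rewrite mdistxx.
  have BE : B = rho x0 (g x0) + k * B by rewrite /B; field; lra.
  rewrite BE (le_trans (metric_triangle _ (g x0) _))// lerD2l.
  by rewrite (le_trans (g_contr _ _ _ _))// ler_wpM2l.
have u_cauchy n m : rho (u n) (u (n + m)%N) <= k ^+ n * B.
  elim: n => [|n IHn]; first by rewrite expr0 mul1r; exact: u_bounded.
  rewrite addSn /= (le_trans (g_contr _ _ _ _))// exprS -mulrA.
  by rewrite ler_wpM2l.
have [l ul] : exists l, u n @[n --> \oo] --> l.
  apply: mdist_cauchy_cvg => e e0.
  have : k ^+ n @[n --> \oo] --> (0 : R) by apply: cvg_expr; rewrite ger0_norm.
  move=> /cvgrPdist_lt/(_ (e / (B + 1)) ltac:(by rewrite divr_gt0//; lra)).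
  move=> [N _ /(_ N (leqnn N))]; rewrite sub0r normrN ger0_norm ?exprn_ge0//.
  rewrite ltr_pdivlMr; last lra.
  move=> kN; exists N => n Nn; rewrite -(subnKC Nn).
  by apply: le_lt_trans (u_cauchy _ _) _; have := exprn_ge0 N k0; lra.
have Sl : S l by apply: closed_cvg ul => //; exact: nearW.
exists l => //; apply/esym/mdist_positivity/le_anti; rewrite mdist_ge0 andbT.
apply/ler_addgt0Pl => e e0; rewrite addr0.
move/mdist_cvgP: ul => /(_ (e / 2) ltac:(lra))[N _ uN].
have := uN N (leqnn N); have := uN N.+1 (leqnSn N) => /=.
have := metric_triangle l (g (u N)) (g l); have := g_contr _ _ (uS N) Sl.
rewrite (metric_sym (u N)); have := mdist_ge0 l (u N).
nra.
Qed.

End complete_metric.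

(** * Nearest fixed points of nonexpansive maps *)

Section nonexpansive_maps.
Context {R : realType} {X : completeMetricType R}.
Hypothesis X_CAT1 : CAT1 X.
Variable D : R.
Hypothesis D_small : D < pi / 2.
Hypothesis X_diam : forall x y : X, mdist x y <= D.
Variable T : X -> X.
Hypothesis T_ne : nonexpansive T.
Local Notation rho := (@mdist R X).
Implicit Types (u w x y z p : X) (s e eta : R).

Let X_small x y : rho x y < pi / 2 := le_lt_trans (X_diam x y) D_small.

Lemma cos_diam_gt0 u : 0 < cos D.
Proof.
apply: cos_gt0_pihalf; have := X_diam u u; rewrite mdistxx; move: D_small.
by have := @pi_ge2 R; lra.
Qed.

Lemma anchored_fixpoint u s : 0 < s < 1 -> exists z, convex_comb s u (T z) z.
Proof.
move=> s01.
have /choice[g gP] x : exists z, convex_comb s u (T x) z.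
  by apply: comb_exists => //; lra.
have c0 := cos_diam_gt0 u; have c1 := cos_le1 D.
have [|||||z _ gz] := @contraction_fixpoint R X setT g (1 - s * cos D).
- exact: closedT.
- by exists u.
- by [].
- by apply/andP; split; nra.
- move=> x y _ _.
  apply: (@le_trans _ _ ((1 - s * cos D) * rho (T x) (T y))).
    exact: (comb_contraction X_CAT1 X_small s01 D_small (X_diam _ _) (X_diam _ _)
      (gP x) (gP y)).
  by rewrite ler_wpM2l//; nra.
by exists z; rewrite -{2}gz.
Qed.

(** [almost_obtuse] applies with [w = T z], as [T] is nonexpansive and [x] is
    almost fixed. *)
Lemma anchored_obtuse u s z x e : 0 < s < 1 -> convex_comb s u (T z) z ->
  rho x (T x) <= e ->
  cos (rho u x) <= cos (rho u z) * cos (rho z x) + 2 * s + e / s.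
Proof.
move=> s01 zs xe; apply: (almost_obtuse X_CAT1 X_small s01 _ zs).
  exact: le_trans (mdist_ge0 _ _) xe.
have := metric_triangle (T z) (T x) x; have := T_ne z x.
by rewrite (metric_sym (T x)); lra.
Qed.

(** The ratios are inverses of factorials so that [s m / s n] tends to [0] as
    well: this is the error made when [z m] is treated as a fixed point in
    [anchored_obtuse] for [z n]. *)
Lemma anchored_path u : exists (s : nat -> R) (z : nat -> X),
  [/\ forall n, 0 < s n < 1, forall n, convex_comb (s n) u (T (z n)) (z n),
      s n @[n --> \oo] --> (0 : R) &
      forall n m : nat, (n < m)%N -> s m / s n <= n.+1%:R^-1].
Proof.
pose s n : R := n.+2`!%:R^-1.
have s0 n : 0 < s n by rewrite invr_gt0 ltr0n fact_gt0.
have s1 n : s n < 1.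
  rewrite invf_lt1 ?ltr0n ?fact_gt0// ltr1n factS.
  by rewrite (leq_trans _ (leq_pmulr _ _)) ?fact_gt0.
have s01 n : 0 < s n < 1 by rewrite s0 s1.
have /choice[z zP] n := anchored_fixpoint u (s01 n).
exists s, z; split => //.
  apply: (@squeeze_cvgr _ _ _ _ (fun=> 0) harmonic).
  - by apply: nearW => n; case/andP: (@inv_fact_le R n) => /ltW -> ->.
  - exact: cvg_cst.
  - exact: cvg_harmonic.
by move=> n m nm; rewrite ler_pdivrMr// mulrC inv_fact_decay.
Qed.

(** The anchored fixed points [z n] of ratio [s n] approach a fixed point [w].
    Comparing [z m] with [z n] by [anchored_obtuse] shows that
    [cos (rho u (z n))] decreases up to errors [s n] and [s m / s n], hence
    converges, which forces [z n] to be a Cauchy sequence. *)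
Lemma approximate_projection u : exists2 w, T w = w &
  forall e, 0 < e -> exists2 eta, 0 < eta & forall x, rho x (T x) <= eta ->
    cos (rho u x) <= cos (rho u w) * cos (rho w x) + e.
Proof.
have [s [z [s01 zP s_cvg s_decay]]] := anchored_path u.
have pb := @pi_bounds R.
have c0 := cos_diam_gt0 u.
have cD x y : cos D <= cos (rho x y).
  by apply: cos_le_mono; rewrite ?mdist_ge0 ?X_diam//; move: D_small; lra.
have zT n : rho (z n) (T (z n)) <= 2 * s n.
  have [_ _ ->] := zP n; have := rho_pihalf X_small u (T (z n)); have := s01 n.
  nra.
pose de n : R := 2 * s n + 2 * n.+1%:R^-1.
have decr n m : (n < m)%N ->
    cos (rho u (z m)) <= cos (rho u (z n)) * cos (rho (z n) (z m)) + de n.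
  move=> nm; have := anchored_obtuse (s01 n) (zP n) (zT m).
  rewrite -(mulrA 2 (s m)) -addrA => h; apply: (le_trans h).
  by rewrite !lerD2l ler_pM2l// s_decay.
have de0 n : 0 <= de n.
  by rewrite addr_ge0// mulr_ge0// ltW//; case/andP: (s01 n).
have de_cvg : de n @[n --> \oo] --> 0.
  have -> : 0 = 2 * 0 + 2 * 0 :> R by rewrite mulr0 addr0.
  apply: cvgD; first by apply: cvgM => //; exact: cvg_cst.
  by apply: cvgM; [exact: cvg_cst|exact: cvg_harmonic].
have [w zw] : exists w, z n @[n --> \oo] --> w.
  apply: mdist_cauchy_cvg => e e0.
  have [epi|epi] := leP pi e.
    exists 0%N => n _; apply: lt_le_trans (X_small _ _) _; lra.
  pose e' := cos D * (1 - cos e) / 3.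
  have ce : cos e < 1 by apply: cos_lt1; lra.
  have e'0 : 0 < e' by rewrite /e' divr_gt0// mulr_gt0//; lra.
  have [|N [deN alN]] := almost_decreasing_cauchy
    (fun n => cos_rho_ge0 X_small u (z n)) de0 _ de_cvg e'0.
    move=> n m nm; apply: le_trans (decr _ _ nm) _; rewrite lerD2r.
    have := cos_rho_ge0 X_small u (z n); have := cos_le1 (rho (z n) (z m)).
    nra.
  exists N => n; rewrite leq_eqVlt => /predU1P[<-|Nn]; first by rewrite mdistxx.
  rewrite ltNge; apply/negP => eN.
  have : cos (rho (z N) (z n)) <= cos e.
    by apply: cos_le_mono; have := rho_pi X_small (z N) (z n); lra.
  have := decr _ _ Nn; have := alN n (ltnW Nn); have := cD u (z N).
  move: (cos (rho u (z N))) (cos (rho u (z n))) (cos (rho _ _)) => A B C.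
  have : e' * 3 = cos D * (1 - cos e) by rewrite divfK.
  nra.
have small e : 0 < e -> exists2 n, 2 * s n <= e & rho w (z n) <= e.
  move=> e0; move/mdist_cvgP: zw => /(_ e e0).
  move/cvgrPdist_lt: s_cvg => /(_ (e / 2) ltac:(lra)) => sN wN.
  have [n _ /(_ n (leqnn n))[h1 h2]] := filterI sN wN.
  exists n; last exact: ltW.
  by move: h1; rewrite sub0r normrN ger0_norm ?(ltW (andP (s01 n)).1)//; lra.
have cosw y n : `|cos (rho y w) - cos (rho y (z n))| <= rho w (z n).
  have h1 := cos_lipschitz (rho y w) (rho y (z n)).
  have h2 := cos_lipschitz (rho y (z n)) (rho y w).
  have h3 : `|rho y w - rho y (z n)| <= rho w (z n).
    have := metric_triangle y w (z n); have := metric_triangle y (z n) w.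
    by rewrite (metric_sym (z n) w) ler_norml; lra.
  by rewrite (distrC (rho y (z n))) in h2; rewrite ler_norml; lra.
exists w.
  apply/esym/mdist_positivity/le_anti; rewrite mdist_ge0 andbT.
  apply/ler_addgt0Pl => e e0; rewrite addr0.
  have [n sn wn] := small (e / 3) ltac:(lra).
  have := metric_triangle w (z n) (T w).
  have := metric_triangle (z n) (T (z n)) (T w).
  have := T_ne (z n) w; have := zT n; rewrite (metric_sym (z n) w); lra.
move=> e e0; have [n sn wn] := small (e / 4) ltac:(lra).
have sn0 : 0 < s n by case/andP: (s01 n).
exists (s n * (e / 4)); first by rewrite mulr_gt0//; lra.
move=> x xT; have := anchored_obtuse (s01 n) (zP n) xT.
have -> : s n * (e / 4) / s n = e / 4 by field; rewrite gt_eqF.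
have := cosw u n; have := cosw x n; rewrite (metric_sym x w) (metric_sym x).
rewrite !ler_norml.
have := cos_rho_ge0 X_small u w; have := cos_le1 (rho u w).
have := cos_rho_ge0 X_small (z n) x; have := cos_le1 (rho (z n) x).
move: wn sn; set A := cos (rho u w); set B := cos (rho u (z n)).
set A' := cos (rho w x); set B' := cos (rho (z n) x).
move=> wn sn B1 B0 A1 A0 AB' AB.
have : (B - A) * B' <= e / 4 by nra.
have : A * (B' - A') <= e / 4 by nra.
lra.
Qed.

Lemma Fix_closed : closed (Fix T).
Proof.
move=> x x_cl; apply/esym/mdist_positivity/le_anti; rewrite mdist_ge0 andbT.
apply/ler_addgt0Pl => e e0; rewrite addr0.
have [|p [Tp]] := x_cl (ball x (e / 2)); first by apply: nbhsx_ballx; lra.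
rewrite ballEmdist /= => xp; have := T_ne p x; rewrite Tp.
by have := metric_triangle x p (T x); rewrite (metric_sym p x); lra.
Qed.

(** A spherical triangle with legs shorter than [pi / 2] and an obtuse or right
    angle at [w] has its longest side opposite to [w]. *)
Lemma obtuse_is_proj u w : T w = w ->
  (forall p, T p = p -> cos (rho u p) <= cos (rho u w) * cos (rho w p)) ->
  is_proj (Fix T) u w.
Proof.
move=> Tw w_obt.
have w_min p : T p = p -> rho u w <= rho u p.
  move=> /w_obt up; apply: cos_ge_le; rewrite ?(rho_pi X_small)//.
  apply: le_trans up _; rewrite -[leRHS]mulr1 ler_wpM2l ?cos_le1//.
  exact: cos_rho_ge0.
have dist_w : set_dist u (Fix T) = rho u w.
  apply/le_anti/andP; split.
    by apply: ge_inf; [exists 0 => _ [p _ <-]; exact: mdist_ge0|exists w].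
  by apply: lb_le_inf; [exists (rho u w), w|move=> _ [p /w_min + <-]].
split; first by rewrite dist_w.
move=> p []; rewrite dist_w => Tp up; have := w_obt p Tp; rewrite up.
have c0 := cos_rho_gt0 X_small u w.
rewrite -{1}[cos (rho u w)]mulr1 ler_pM2l// => wp.
apply: (@rho_eq0 _ X); apply/le_anti; rewrite mdist_ge0 andbT.
by apply: cos_ge_le; rewrite ?cos0 ?(rho_pi X_small)// lexx pi_ge0.
Qed.

Lemma approximate_is_proj u w : T w = w ->
  (forall e, 0 < e -> exists2 eta, 0 < eta & forall x, rho x (T x) <= eta ->
    cos (rho u x) <= cos (rho u w) * cos (rho w x) + e) ->
  is_proj (Fix T) u w.
Proof.
move=> Tw w_appr; apply: obtuse_is_proj => // p Tp; apply/ler_addgt0Pr => e e0.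
by have [eta eta0] := w_appr e e0; apply; rewrite Tp mdistxx ltW.
Qed.

Lemma is_proj_fun (S : set X) u w w' : is_proj S u w -> is_proj S u w' -> w = w'.
Proof. by move=> [_ w_uniq] [? _]; exact: w_uniq. Qed.

(** The nearest point is unique, so it is the limit of the anchored fixed
    points. *)
Lemma is_proj_approximate u w : is_proj (Fix T) u w ->
  forall e, 0 < e -> exists2 eta, 0 < eta & forall x, rho x (T x) <= eta ->
    cos (rho u x) <= cos (rho u w) * cos (rho w x) + e.
Proof.
have [w' Tw' w'_appr] := approximate_projection u => w_proj.
by rewrite (is_proj_fun w_proj (approximate_is_proj Tw' w'_appr)).
Qed.

Lemma is_proj_obtuse u w p : is_proj (Fix T) u w -> T p = p ->
  cos (rho u p) <= cos (rho u w) * cos (rho w p).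
Proof.
move=> w_proj Tp; apply/ler_addgt0Pr => e e0.
have [eta eta0] := is_proj_approximate w_proj e0.
by apply; rewrite Tp mdistxx ltW.
Qed.

Lemma proj_exists u : exists w, is_proj (Fix T) u w.
Proof.
have [w Tw w_appr] := approximate_projection u.
by exists w; exact: approximate_is_proj.
Qed.

(** The two obtuse angles at [w1] and [w2] bound the diagonals in
    [cos_quadrilateral]. *)
Lemma proj_lipschitz u1 u2 w1 w2 :
  is_proj (Fix T) u1 w1 -> is_proj (Fix T) u2 w2 ->
  (cos (rho u1 w1) + cos (rho u2 w2) - 1) * (1 - cos (rho w1 w2))
    <= 1 - cos (rho u1 u2).
Proof.
move=> p1 p2; have [[Tw1 _] _] := p1; have [[Tw2 _] _] := p2.
have := is_proj_obtuse p1 Tw2; have := is_proj_obtuse p2 Tw1.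
have := cos_quadrilateral X_CAT1 X_small u1 w1 w2 u2.
rewrite (metric_sym u2 u1) (metric_sym w2 u2) (metric_sym w2 w1) (metric_sym u2 w1).
lra.
Qed.

(** [proj_lipschitz] and the chordal metric: halving distances multiplies
    [1 - cos] by at most [1 / 3.4], and [1 / (3.4 * 0.84) < (3 / 5) ^ 2]. *)
Lemma proj_contraction p1 p2 u1 u2 w1 w2 : T p1 = p1 -> T p2 = p2 ->
  rho u1 p1 <= pi / 8 -> rho u2 p2 <= pi / 8 -> rho u1 u2 <= rho p1 p2 / 2 ->
  is_proj (Fix T) u1 w1 -> is_proj (Fix T) u2 w2 ->
  rho w1 w2 <= 3 / 5 * rho p1 p2.
Proof.
move=> Tp1 Tp2 up1 up2 u12 pr1 pr2.
have near u p w : T p = p -> rho u p <= pi / 8 -> is_proj (Fix T) u w ->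
    23 / 25 <= cos (rho u w).
  move=> Tp up pr; apply: (le_trans cos_pi8).
  have h : cos (pi / 8) <= cos (rho u p).
    by apply: cos_le_mono; rewrite ?mdist_ge0//; have := @pi_ge2 R; lra.
  have := is_proj_obtuse pr Tp; have := cos_le1 (rho w p).
  by have := cos_rho_ge0 X_small u w; nra.
have h1 := near _ _ _ Tp1 up1 pr1; have h2 := near _ _ _ Tp2 up2 pr2.
have lip := proj_lipschitz pr1 pr2.
have pd := rho_pihalf X_small p1 p2; have pg := @pi_ge2 R.
have cu : cos (rho p1 p2 / 2) <= cos (rho u1 u2).
  by apply: cos_le_mono; rewrite ?mdist_ge0//; lra.
have ch : 7 / 10 <= cos (rho p1 p2 / 2).
  by apply: (le_trans cos_pi4); apply: cos_le_mono; lra.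
have dbl := cosB1_double (rho p1 p2).
apply: chord_contraction; rewrite ?(rho_pi X_small)//; first lra.
have e1 : 0 <= 1 - cos (rho w1 w2) by have := cos_le1 (rho w1 w2); lra.
have d1 : 0 <= 1 - cos (rho p1 p2 / 2) by have := cos_le1 (rho p1 p2 / 2); lra.
have l1 : 84 / 100 * (1 - cos (rho w1 w2)) <= 1 - cos (rho u1 u2).
  by apply: le_trans lip; rewrite ler_wpM2r//; lra.
have l2 : 34 / 10 * (1 - cos (rho p1 p2 / 2)) <= 1 - cos (rho p1 p2).
  by rewrite dbl; nra.
lra.
Qed.

Lemma viscosity_fixpoint (f : X -> X) : Fix T !=set0 ->
  (forall x y, rho (f x) (f y) <= rho x y / 2) ->
  (forall p, Fix T p -> rho p (f p) <= pi / 8) ->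
  exists q, unique (fun q => Fix T q /\ is_proj (Fix T) (f q) q) q.
Proof.
move=> FT f_half f_near.
have /choice[g gP] p := proj_exists (f p).
have g_contr p1 p2 w1 w2 : Fix T p1 -> Fix T p2 ->
    is_proj (Fix T) (f p1) w1 -> is_proj (Fix T) (f p2) w2 ->
    rho w1 w2 <= 3 / 5 * rho p1 p2.
  move=> Tp1 Tp2; apply: proj_contraction => //.
    by rewrite metric_sym f_near.
  by rewrite metric_sym f_near.
have [|||q Tq gq] := @contraction_fixpoint _ X _ g (3 / 5) Fix_closed FT.
- by move=> p _; have [[]] := gP p.
- by lra.
- by move=> p1 p2 Tp1 Tp2; exact: g_contr.
exists q; split; first by split=> //; rewrite -{2}gq.
move=> q' [Tq' q'P]; have := g_contr _ _ _ _ Tq Tq' (gP q) q'P; rewrite gq => qq'.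
by apply: mdist_positivity; have := mdist_ge0 q q'; lra.
Qed.

(** * The viscosity iteration *)

Section one_step.
Variables (f : X -> X) (M k : R) (q : X).
Hypothesis M_bounds : 0 < M < pi / 2.
Hypothesis k_ge0 : 0 <= k.
Hypothesis k_small : 2 * k <= cos M.
Hypothesis f_contr : forall x y, rho (f x) (f y) <= k * rho x y.
Hypothesis Tq : T q = q.
Hypothesis fq_near : rho q (f q) <= M / 4.
Implicit Types (b t c : R).

Let phi x := 1 - cos (rho x q).

(** The left hand side bounds [rho (f x) x] when [rho x q <= M / 2]. The bound
    follows from [k <= cos M / 2] and [cos M <= pi / 2 - M]. *)
Lemma step_radius : 3 * M / 4 + k * M / 2 <= 3 * pi / 8.
Proof.
have Mb := M_bounds; have := @sin_le_id R (pi / 2 - M) ltac:(lra).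
rewrite sinB sin_pihalf cos_pihalf mul1r mul0r subr0.
by have := @pi_bounds R; move: k_small; nra.
Qed.

Lemma phi_ge0 x : 0 <= phi x.
Proof. by rewrite subr_ge0 cos_le1. Qed.

(** The left hand side is, in the sphere, the first order variation of
    [1 - cos (rho x q)] when [x] moves towards [f x]. Applying
    [cos_quadrilateral] to [f x], [x], [q], [f q] replaces [f x] by [f q], whose
    angle at [q] is almost obtuse by assumption. The remaining coefficient of
    [phi x] is at most
    [1 + 1 / 3.84 - (cos (pi / 8) + cos (3 pi / 8)) < - 1 / 50]. *)
Lemma first_variation x e : rho x q <= M / 2 ->
  cos (rho (f q) x) <= cos (rho (f q) q) * cos (rho q x) + e ->
  cos (rho (f x) (T x)) * cos (rho x q) - cos (rho (f x) q)
    <= - (phi x / 50) + (e + rho x (T x)).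
Proof.
move=> xq fqx.
have pg := @pi_bounds R; have x0 := mdist_ge0 x q.
have := cos_quadrilateral X_CAT1 X_small (f x) x q (f q).
rewrite (metric_sym (f q) q) (metric_sym (f q) (f x)) (metric_sym q x) in fqx *.
rewrite (metric_sym (f q) x) in fqx => quad.
have tri : rho (f x) x <= 3 * M / 4 + k * M / 2.
  have := metric_triangle (f x) (f q) x; have := metric_triangle (f q) q x.
  rewrite (metric_sym (f q) q) (metric_sym q x); have := f_contr x q.
  have : k * rho x q <= k * (M / 2) by rewrite ler_wpM2l.
  by move: fq_near; lra.
have a38 : cos (3 * pi / 8) <= cos (rho (f x) x).
  by apply: cos_le_mono; rewrite ?mdist_ge0//; have := step_radius; lra.
have h8 : cos (pi / 8) <= cos (rho q (f q)).
  by apply: cos_le_mono; rewrite ?mdist_ge0//; move: fq_near M_bounds; lra.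
have sum : 1288 / 1000 <= cos (3 * pi / 8) + cos (pi / 8) :> R.
  have -> : 3 * pi / 8 = pi / 4 + pi / 8 :> R by lra.
  have {2}-> : pi / 8 = pi / 4 - pi / 8 :> R by lra.
  by rewrite cosD cosB; have := @cos_pi4 R; have := @cos_pi8 R; nra.
have fxq : 384 / 100 * (1 - cos (rho (f x) (f q))) <= phi x.
  have k2 : k <= 1 / 2 by move: k_small; have := cos_le1 M; lra.
  have h : cos (rho x q / 2) <= cos (rho (f x) (f q)).
    apply: cos_le_mono; rewrite ?mdist_ge0//; last first.
      by have := rho_pi X_small x q; lra.
    by have := f_contr x q; nra.
  have h' : 92 / 100 <= cos (rho x q / 2).
    apply: le_trans (cos_le_mono _ _ _); last 3 first.
    - by apply: divr_ge0.
    - by apply: (_ : _ <= pi / 8); move: M_bounds; lra.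
    - by lra.
    by have := @cos_pi8 R; lra.
  have := cos_le1 (rho x q / 2); rewrite /phi (cosB1_double (rho x q)); nra.
have lip : cos (rho (f x) (T x)) <= cos (rho (f x) x) + rho x (T x).
  apply: le_trans (cos_lipschitz _ (rho (f x) x)) _; rewrite lerD2l.
  have := metric_triangle (f x) x (T x); have := metric_triangle (f x) (T x) x.
  by rewrite (metric_sym (T x)) ler_norml; lra.
have A0 := cos_rho_ge0 X_small x q; have A1 := cos_le1 (rho x q).
have xT0 := mdist_ge0 x (T x).
have l1 : cos (rho (f x) (T x)) * cos (rho x q) <=
    cos (rho (f x) x) * cos (rho x q) + rho x (T x) by nra.
have l2 : 1288 / 1000 * phi x <= (cos (rho (f x) x) + cos (rho q (f q))) * phi x.
  by rewrite ler_wpM2r ?phi_ge0//; lra.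
move: l2 fxq; have := phi_ge0 x; rewrite /phi; lra.
Qed.

Lemma cos_rho_T x : cos (rho x q) <= cos (rho (T x) q).
Proof.
apply: cos_le_mono; rewrite ?mdist_ge0//.
  by rewrite -{1}Tq T_ne.
by have := rho_pi X_small x q; lra.
Qed.

(** Put [d = rho (f x) (T x)]. Since
    [sin ((1 - t) d) = sin d cos (t d) - cos d sin (t d)], [cos_segment] bounds
    [phi y - phi x] by [sin (t d) / sin d] times the first variation, up to
    [1 - cos (t d) <= 2 t ^ 2]; and [t <= sin (t d) / sin d <= 2 t]. *)
Lemma anchor_step x y t e : 0 < t < 1 -> 0 <= e ->
  convex_comb t (f x) (T x) y ->
  cos (rho (f x) (T x)) * cos (rho x q) - cos (rho (f x) q)
    <= - (phi x / 50) + e ->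
  phi y <= phi x - t * phi x / 50 + 2 * t * e + 2 * t ^+ 2.
Proof.
move=> t01 e0 ty; set G := _ - _ => G_le.
have Tx := cos_rho_T x; have p0 := phi_ge0 x.
have t2 := sqr_ge0 t.
have := mdist_ge0 (f x) (T x); rewrite le_eqVlt => /predU1P[/esym fT|d0].
  have [-> eT] := comb_diag ty fT.
  move: G_le; rewrite /G fT cos0 mul1r => G_le; rewrite eT in Tx.
  move: G_le p0; rewrite /phi; set A := cos (rho x q) in Tx *.
  move: Tx; set B := cos (rho (f x) q) => Tx G_le p0.
  have : 0 <= t * e by rewrite mulr_ge0//; lra.
  have : t * (A - B) <= t * (- ((1 - A) / 50) + e) by rewrite ler_wpM2l//; lra.
  have : (1 - t) * (A - B) <= 0 by nra.
  lra.
have [seg fy yT] := ty; have := cos_segment X_CAT1 X_small q seg; rewrite fy yT.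
set d := rho (f x) (T x) in d0 fy yT G G_le *.
have dpi := rho_pihalf X_small (f x) (T x); rewrite -/d in dpi.
have pb := @pi_bounds R.
have sd : 0 < sin d by apply: (sin_rho_gt0 X_small).
have eq1 : sin ((1 - t) * d) = sin d * cos (t * d) - cos d * sin (t * d).
  by rewrite -sinB; congr sin; lra.
have td0 : 0 <= t * d by apply: mulr_ge0; lra.
have s1 := @sin_concave _ t d ltac:(lra) ltac:(lra).
have s2 : sin (t * d) <= 2 * t * sin d.
  apply: (le_trans (sin_le_id td0)); have := @sin_ge_half _ d ltac:(lra); nra.
have s3 : 0 <= sin ((1 - t) * d) by apply: sin_ge0_pi; nra.
have c1 : 1 - cos (t * d) <= 2 * t ^+ 2.
  have := cosB1_le_sq td0; rewrite exprMn.
  have : d ^+ 2 <= 4 by nra.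
  by nra.
have c2 := cos_le1 (t * d).
have A0 := cos_rho_ge0 X_small x q; have A1 := cos_le1 (rho x q).
move=> h; rewrite -(ler_pM2l sd).
have h1 : sin ((1 - t) * d) * cos (rho x q) <= sin ((1 - t) * d) * cos (rho (T x) q).
  by rewrite ler_wpM2l.
have st0 : 0 <= sin (t * d) by apply: le_trans s1; rewrite mulr_ge0//; lra.
have h2 : sin (t * d) * G <= sin (t * d) * (- (phi x / 50) + e).
  by rewrite ler_wpM2l.
have h3 : t * sin d * phi x <= sin (t * d) * phi x by rewrite ler_wpM2r.
have h4 : sin (t * d) * e <= 2 * t * sin d * e by rewrite ler_wpM2r.
have h5 : cos (rho x q) * (1 - cos (t * d)) <= 2 * t ^+ 2.
  by apply: le_trans c1; rewrite ler_piMl// subr_ge0.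
have h6 : sin d * (cos (rho x q) * (1 - cos (t * d))) <= sin d * (2 * t ^+ 2).
  by rewrite ler_wpM2l// ltW.
rewrite eq1 in h h1; move: h2 h3; rewrite /phi /G; lra.
Qed.

Lemma anchor_step_crude x y t : 0 < t < 1 -> convex_comb t (f x) (T x) y ->
  phi y <= phi x + t.
Proof.
move=> t01 ty; have := cos_comb X_CAT1 X_small q _ ty => /(_ ltac:(lra)).
have := cos_rho_T x; have := cos_rho_ge0 X_small (f x) q.
have := cos_le1 (rho x q); have := cos_rho_ge0 X_small x q.
rewrite /phi; nra.
Qed.

Lemma averaging_step x y z b : 0 < b < 1 -> convex_comb b x y z ->
  phi z <= b * phi x + (1 - b) * phi y.
Proof.
move=> b01 bz; have := cos_comb X_CAT1 X_small q _ bz => /(_ ltac:(lra)).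
rewrite /phi; lra.
Qed.

(** Uniform convexity: as [4 sin (d / 2) sin (b d / 2) sin ((1 - b) d / 2)] is
    [sin (b d) + sin ((1 - b) d) - sin d], an average of two points at distance
    [d] is closer to [q] by a definite amount. *)
Lemma averaging_gain x y z b t : rho x q <= pi / 4 -> 0 < b < 1 -> 0 <= t ->
  convex_comb b x y z -> phi y <= phi x + t ->
  phi z <= phi x - b * (1 - b) * (1 - cos (rho x y)) / 2 + t.
Proof.
move=> xq b01 t0 bz yx.
have := mdist_ge0 x y; rewrite le_eqVlt => /predU1P[/esym xy|d0].
  by have [-> _] := comb_diag bz xy; rewrite xy cos0; lra.
have [seg xz zy] := bz; have := cos_segment X_CAT1 X_small q seg; rewrite xz zy.
set d := rho x y in d0 xz zy *.
have dpi := rho_pihalf X_small x y; rewrite -/d in dpi.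
have pb := @pi_bounds R.
have sd : 0 < sin d by apply: (sin_rho_gt0 X_small).
have sh : 0 <= sin (d / 2) by apply: sin_ge0_pi; lra.
have s1 := @sin_concave _ b (d / 2) ltac:(lra) ltac:(lra).
have s2 := @sin_concave _ (1 - b) (d / 2) ltac:(lra) ltac:(lra).
have gain : sin d + b * (1 - b) * (1 - cos d) * sin d <=
    sin (b * d) + sin ((1 - b) * d).
  have := sin_double_sum (b * (d / 2)) ((1 - b) * (d / 2)).
  have -> : b * (d / 2) + b * (d / 2) = b * d by lra.
  have -> : (1 - b) * (d / 2) + (1 - b) * (d / 2) = (1 - b) * d by lra.
  have -> : b * (d / 2) + (1 - b) * (d / 2) = d / 2 by lra.
  rewrite -splitr => ->; rewrite lerD2l cosB1_sin.
  have s3 : (b * sin (d / 2)) * ((1 - b) * sin (d / 2)) <=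
      sin (b * (d / 2)) * sin ((1 - b) * (d / 2)).
    by rewrite ler_pM// mulr_ge0//; lra.
  have s4 : sin d <= 2 * sin (d / 2).
    by rewrite {1}(splitr d) sinD; have := cos_le1 (d / 2); nra.
  have w0 : 0 <= 2 * (b * (1 - b)) * sin (d / 2) ^+ 2.
    by rewrite !mulr_ge0//; nra.
  have h1 := ler_wpM2l w0 s4.
  have h2 := ler_wpM2l (mulr_ge0 (ltac:(lra) : 0 <= 4 :> R) sh) s3.
  lra.
have sb : sin ((1 - b) * d) <= sin d.
  have := @sin_shrink _ b d d ltac:(lra) ltac:(lra) ltac:(lra).
  have cd0 : 0 <= cos d by apply: cos_ge0_pihalf; lra.
  by have : 0 <= b * cos d * sin d; [rewrite !mulr_ge0//; lra|lra].
have A7 : 7 / 10 <= cos (rho x q).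
  by apply: (le_trans cos_pi4); apply: cos_le_mono; rewrite ?mdist_ge0//; lra.
move=> h; rewrite -(ler_pM2l sd).
have sb0 : 0 <= sin ((1 - b) * d) by apply: sin_ge0_pi; nra.
have h1 : sin ((1 - b) * d) * (cos (rho x q) - t) <=
    sin ((1 - b) * d) * cos (rho y q).
  by rewrite ler_wpM2l//; move: yx; rewrite /phi; lra.
have h2 : (sin d + b * (1 - b) * (1 - cos d) * sin d) * cos (rho x q) <=
    (sin (b * d) + sin ((1 - b) * d)) * cos (rho x q).
  by rewrite ler_wpM2r//; lra.
have h3 : sin ((1 - b) * d) * t <= sin d * t by rewrite ler_wpM2r.
have g0 : 0 <= b * (1 - b) * (1 - cos d) * sin d.
  have [b0 b1] := andP b01.
  by rewrite !mulr_ge0 ?subr_ge0 ?cos_le1 ?ltW.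
have h4 : b * (1 - b) * (1 - cos d) * sin d / 2 <=
    b * (1 - b) * (1 - cos d) * sin d * cos (rho x q).
  by rewrite ler_wpM2l//; lra.
rewrite /phi; lra.
Qed.

(** [rho (f x) q <= k M / 2 + M / 4 <= M / 2], and balls of radius less than
    [pi / 2] are convex by [cos_comb]. *)
Lemma ball_invariant x y z b t : 0 < b < 1 -> 0 < t < 1 -> rho x q <= M / 2 ->
  convex_comb t (f x) (T x) y -> convex_comb b x y z -> rho z q <= M / 2.
Proof.
move=> b01 t01 xq ty bz; have pg := @pi_bounds R; have Mb := M_bounds.
have k2 : k <= 1 / 2 by move: k_small; have := cos_le1 M; lra.
have cM p : rho p q <= M / 2 -> cos (M / 2) <= cos (rho p q).
  by move=> pq; apply: cos_le_mono; rewrite ?mdist_ge0//; lra.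
have fx : cos (M / 2) <= cos (rho (f x) q).
  apply: cM; have := metric_triangle (f x) (f q) q; have := f_contr x q.
  have := fq_near; rewrite (metric_sym q (f q)).
  have : k * rho x q <= 1 / 2 * (M / 2) by rewrite ler_pM// mdist_ge0.
  lra.
have Tx : cos (M / 2) <= cos (rho (T x) q).
  exact: le_trans (cM _ xq) (cos_rho_T x).
have hy : cos (M / 2) <= cos (rho y q).
  have := cos_comb X_CAT1 X_small q _ ty => /(_ ltac:(lra)); nra.
apply: cos_ge_le; rewrite ?(rho_pi X_small)//; first lra.
have := cos_comb X_CAT1 X_small q _ bz => /(_ ltac:(lra)).
by have := cM _ xq; nra.
Qed.

(** Either [x] is almost fixed by [T], and [first_variation] makes [phi] decrease
    by the factor [1 - g t / 50] up to [6 e t]; or [x] and [y] are far apart, and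
    the gain of [averaging_gain] outweighs [2 t]. *)
Lemma iteration_step x y z b t g e eta :
  0 < e -> 0 < eta <= 1 -> eta <= e ->
  (forall x, rho x (T x) <= eta ->
    cos (rho (f q) x) <= cos (rho (f q) q) * cos (rho q x) + e) ->
  0 < g -> g <= b <= 1 - g -> 0 < t < 1 ->
  4 * t <= eta -> 4 * t <= g ^+ 2 * (1 - cos (eta / 2)) ->
  rho x q <= M / 2 ->
  convex_comb t (f x) (T x) y -> convex_comb b x y z ->
  phi z <= (1 - g / 50 * t) * phi x + 6 * e * t.
Proof.
move=> e0 eta01 eta_e appr g0 gb t01 t_eta t_g xq ty bz.
have pg := @pi_bounds R; have Mb := M_bounds.
have p0 := phi_ge0 x; have et0 : 0 <= e * t by rewrite mulr_ge0//; lra.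
have b01 : 0 < b < 1 by lra.
have [xy|xy] := leP (rho x y) (eta / 2).
  have xT : rho x (T x) <= eta.
    have := metric_triangle x y (T x); have [_ _ ->] := ty.
    have := rho_pihalf X_small (f x) (T x); nra.
  have fv := first_variation xq (appr x xT).
  have Ge : cos (rho (f x) (T x)) * cos (rho x q) - cos (rho (f x) q)
      <= - (phi x / 50) + 2 * e by lra.
  have yx := anchor_step t01 (mulr_ge0 (ler0n _ 2) (ltW e0)) ty Ge.
  have zy := averaging_step b01 bz.
  have tp0 : 0 <= t * phi x by rewrite mulr_ge0//; lra.
  have h1 : (1 - b) * phi y <=
      (1 - b) * (phi x - t * phi x / 50 + 2 * t * (2 * e) + 2 * t ^+ 2).
    by rewrite ler_wpM2l//; lra.
  have h2 : t ^+ 2 <= e * t by nra.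
  have h3 : g * (t * phi x) <= (1 - b) * (t * phi x) by rewrite ler_wpM2r//; lra.
  have h4 : (1 - b) * (2 * t * (2 * e) + 2 * t ^+ 2) <= 6 * (e * t).
    by have := sqr_ge0 t; nra.
  lra.
have yx := anchor_step_crude t01 ty.
have gain := averaging_gain ltac:(lra) b01 (ltW (andP t01).1) bz yx.
have p1 : phi x <= 1 by have := cos_rho_ge0 X_small x q; rewrite /phi; lra.
have cxy : 1 - cos (eta / 2) <= 1 - cos (rho x y).
  by rewrite lerD2l lerN2; apply: cos_le_mono; have := rho_pi X_small x y; lra.
have ce : 0 <= 1 - cos (eta / 2) by have := cos_le1 (eta / 2); lra.
have bb : g ^+ 2 <= b * (1 - b).
  have gb' : g <= 1 - b by lra.
  by rewrite expr2 ler_pM ?(ltW g0)//; case/andP: gb.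
have h1 : g ^+ 2 * (1 - cos (eta / 2)) <= b * (1 - b) * (1 - cos (rho x y)).
  by rewrite ler_pM// sqr_ge0.
have h2 : g / 50 * t * phi x <= t.
  have -> : g / 50 * t * phi x = t * (g / 50 * phi x) by ring.
  by rewrite ler_piMr//; [lra|rewrite mulr_ile1//; lra].
lra.
Qed.

End one_step.

End nonexpansive_maps.

Theorem theorem4p1 (R : realType) (C : completeMetricType R)
    (T f : C -> C) (M k : R) :
  CAT1 C -> N_property C -> (diameter C < (pi / 2)%:E)%E ->
  nonexpansive T -> Fix T !=set0 ->
  0 < M < pi / 2 ->
  k_contraction k f ->
  k < 2 * sin (M / 2) ^+ 2 * cos M / M ^+ 2 ->
  (forall p, Fix T p -> mdist p (f p) <= M / 4) ->
  exists q : C,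
    unique (fun q => Fix T q /\ is_proj (Fix T) (f q) q) q /\
    forall u : C, mdist u q <= M / 4 ->
    forall b t : nat -> R,
      (forall n, 0 < b n < 1 /\ 0 < t n < 1) ->
      [/\ 0 < limn_inf b, limn_inf b <= limn_sup b & limn_sup b < 1] ->
      t n @[n --> \oo] --> 0 ->
      series t n @[n --> \oo] --> +oo ->
    forall x y : nat -> C, viscosity_iteration T f b t u x y ->
      x n @[n --> \oo] --> q.
Proof.
move=> C_CAT1 _ C_diam T_ne FT Mb [/andP[k0 k1] f_contr] k_bound f_near.
have pg := @pi_bounds R.
(* From [sin (M / 2) <= M / 2]; this is the form in which [k] enters. *)
have k_small : 2 * k <= cos M.
  have cM : 0 <= cos M by apply: cos_ge0_pihalf; lra.
  have sM0 : 0 <= sin (M / 2) by apply: sin_ge0_pi; lra.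
  have sM : sin (M / 2) <= M / 2 by apply: sin_le_id; lra.
  have sM2 : sin (M / 2) ^+ 2 <= (M / 2) ^+ 2 by rewrite lerXn2r ?nnegrE//; lra.
  move: k_bound; rewrite ltr_pdivlMr ?exprn_gt0//; last by lra.
  have M2 : 0 < M ^+ 2 by rewrite exprn_gt0//; lra.
  move=> h; rewrite -(ler_pM2r M2); have := ler_wpM2r cM sM2; lra.
have k2 : k <= 1 / 2 by have := cos_le1 M; lra.
have [u0 _] := FT.
have diam_ub (x y : C) : ((mdist x y)%:E <= diameter C)%E.
  by apply: ereal_sup_ubound; exists (x, y).
have diam_fin : diameter C \is a fin_num.
  rewrite fin_numE; apply/andP; split.
    by apply: contraTneq (diam_ub u0 u0) => ->; rewrite leeNy_eq.
  by apply: contraTneq C_diam => ->; rewrite -leNgt leey.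
pose D := fine (diameter C).
have D_small : D < pi / 2 by rewrite -lte_fin fineK.
have C_diam' (x y : C) : mdist x y <= D by rewrite -lee_fin fineK.
have f_half (x y : C) : mdist (f x) (f y) <= mdist x y / 2.
  by apply: (le_trans (f_contr x y)); have := mdist_ge0 x y; nra.
have f_near' p : Fix T p -> mdist p (f p) <= pi / 8.
  by move=> /f_near; lra.
have [q q_uniq] := viscosity_fixpoint C_CAT1 D_small C_diam' T_ne FT f_half f_near'.
exists q; split=> // u uq b t bt [b_inf _ b_sup] t_cvg t_dvg x y [x0 xy].
have [[Tq q_proj] _] := q_uniq.
have b01 n : 0 < b n < 1 by have [] := bt n.
have t01 n : 0 < t n < 1 by have [] := bt n.
have ball n : mdist (x n) q <= M / 2.
  elim: n => [|n IHn]; first by rewrite x0; lra.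
  have [ty bz] := xy n.
  exact: (ball_invariant C_CAT1 D_small C_diam' T_ne Mb k0 k_small f_contr
    Tq (f_near _ Tq) (b01 n) (t01 n) IHn ty bz).
have [g g0 [N _ gb]] := unit_limn_bounds b01 b_inf b_sup.
have g1 : g < 1 by have := gb N (leqnn N) => /= ?; have := b01 N; lra.
have phi_cvg : 1 - cos (mdist (x n) q) @[n --> \oo] --> 0.
  apply: (@vanishing_recursion _ _ t (g / 50)) => //; [lra|move=> e e0].
  have [eta0 eta00 appr] := is_proj_approximate C_CAT1 D_small C_diam' T_ne q_proj
    (ltac:(lra) : 0 < e / 6).
  (* The constant [6] of [iteration_step] is absorbed in [e]. *)
  pose eta := Num.min eta0 (Num.min (e / 6) 1).
  have eta_gt0 : 0 < eta by rewrite !lt_min eta00 ltr01; lra.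
  have [eta_le0 [eta_e eta1]] : eta <= eta0 /\ (eta <= e / 6 /\ eta <= 1).
    by rewrite !ge_min !lexx ?orbT.
  clearbody eta; have c0 : 0 < g ^+ 2 * (1 - cos (eta / 2)).
    by rewrite mulr_gt0 ?exprn_gt0// subr_gt0 cos_lt1//; lra.
  have t_small d : 0 < d -> \forall n \near \oo, 4 * t n <= d.
    move=> d0; move/cvgrPdist_lt: t_cvg => /(_ (d / 4) ltac:(lra)).
    apply: filterS => n; rewrite sub0r normrN ger0_norm; last by have := t01 n; lra.
    by lra.
  have t1 := t_small _ eta_gt0; have t2 := t_small _ c0.
  near=> n.
  have [ty bz] := xy n.
  have -> : e * t n = 6 * (e / 6) * t n by lra.
  apply: (iteration_step C_CAT1 D_small C_diam' T_ne Mb k0 k_small f_contr Tq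
    (f_near _ Tq) _ _ eta_e _ g0 _ (t01 n) _ _ (ball n) ty bz) => //.
  - by lra.
  - by rewrite eta_gt0.
  - by move=> z zT; apply: appr; exact: le_trans eta_le0.
  - by near: n; exists N.
  - by near: n.
  - by near: n.
apply/mdist_cvgP => e e0.
have [epi|epi] := leP pi e.
  apply: nearW => n; apply: le_lt_trans (C_diam' _ _) _; lra.
have ce : 0 < 1 - cos e.
  by rewrite subr_gt0 cos_lt1//; lra.
move/cvgrPdist_lt: phi_cvg => /(_ _ ce); apply: filterS => n.
rewrite sub0r normrN ger0_norm ?subr_ge0 ?cos_le1// => h.
rewrite metric_sym ltNge; apply/negP => en.
have : cos (mdist (x n) q) <= cos e.
  by apply: cos_le_mono; have := C_diam' (x n) q; lra.
lra.
Unshelve. all: by end_near. Qed.
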